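(* Let $0\le k\le 1$, $0<\beta\le 1$, $\lambda\ge 0$, $0\le\nu<1$. The class $\overline{\mathcal{HM}}(\beta,\lambda,k,\nu)$ is closed under convex combination: if $f_i\in\overline{\mathcal{HM}}(\beta,\lambda,k,\nu)$ for $i=1,2,\dots$ and $0\le t_i\le1$ with $\sum_{i=1}^\infty t_i=1$, then $\sum_{i=1}^\infty t_if_i\in\overline{\mathcal{HM}}(\beta,\lambda,k,\nu)$.
   Context: $\mathcal D=\{z\in\mathbb C:|z|<1\}$. $\mathcal H$ is the class of all complex-valued harmonic functions $f=h+\overline g$ that are univalent and sense preserving in $\mathcal D$, where $h(z)=z+\sum_{n=2}^\infty a_nz^n$ and $g(z)=\sum_{n=1}^\infty b_nz^n$ are analytic in $\mathcal D$ and $|b_1|<1$. For $0\le\nu<1$ the (Owa–Srivastava fractional derivative) operator $\Omega^\nu$ acts on an analytic power series by $\Omega^\nu\big(\sum_{n\ge1}c_nz^n\big)=\sum_{n\ge1}\frac{\Gamma(2-\nu)\Gamma(n+1)}{\Gamma(n+1-\nu)}c_nz^n$, and for $f=h+\overline g$ one sets $\Omega^\nu f=\Omega^\nu h+\overline{\Omega^\nu g}$. For $z=re^{i\theta}$ put $z'=\frac{\partial}{\partial\theta}(re^{i\theta})=iz$, $z''=\frac{\partial}{\partial\theta}z'=-z$, $(\Omega^\nu f)'=\frac{\partial}{\partial\theta}\Omega^\nu f(re^{i\theta})$ and $(\Omega^\nu f)''=\frac{\partial^2}{\partial\theta^2}\Omega^\nu f(re^{i\theta})$. For $0\le k\le1$,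 $0<\beta\le1$, $\lambda\ge0$, $0\le\nu<1$, $\mathcal{HM}(\beta,\lambda,k,\nu)$ is the class of $f\in\mathcal H$ such that $$\operatorname{Re}\left\{(1-\lambda)\frac{\Omega^\nu f}{z}+\lambda(1-k)\frac{(\Omega^\nu f)'}{z'}+\lambda k\frac{(\Omega^\nu f)''}{z''}\right\}>\beta\qquad\text{for all } z\in\mathcal D,\ z\neq0.$$ $\overline{\mathcal{HM}}(\beta,\lambda,k,\nu)$ is the subclass of those $f=h+\overline g\in\mathcal{HM}(\beta,\lambda,k,\nu)$ with $h(z)=z-\sum_{n=2}^\infty|a_n|z^n$, $g(z)=\sum_{n=1}^\infty|b_n|z^n$, $|b_1|<1$. *)

(* Defs.v *)
From Stdlib Require Import Reals.
From Coquelicot Require Import Coquelicot.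

Open Scope R_scope.

Definition in_disc (z : C) : Prop := Cmod z < 1.

(** Euler's Gamma function; the integral converges, so that this is the usual
    value, exactly for [0 < x]. *)
Definition Gamma (x : R) : R :=
  RInt_gen (fun t => Rpower t (x - 1) * exp (- t))
           (at_right 0) (Rbar_locally p_infty).

(** An analytic function on the disc is represented by the sequence of its
    Taylor coefficients at [0]. *)
Definition analytic_coefs (c : nat -> C) : Prop :=
  forall z : C, in_disc z -> exists s : C, is_pseries c z s.

(** Sum of the complex power series with coefficients [c]
    (an arbitrary value where the series diverges). *)
Definition CPSeries (c : nat -> C) (z : C) : C :=
  @iota C_CompleteNormedModule (fun s : C => is_pseries c z s).

(** The harmonic function [h + conj g], from the coefficients of [h] and [g]. *)
Definition harm (a b : nat -> C) (z : C) : C :=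
  Cplus (CPSeries a z) (Cconj (CPSeries b z)).

Definition univalent (f : C -> C) : Prop :=
  forall z w : C, in_disc z -> in_disc w -> f z = f w -> z = w.

(** Jacobian determinant of [f = u + i v] seen as a map of the real plane. *)
Definition jacobian (f : C -> C) (z : C) : R :=
  Derive (fun x => Re (f (x, Im z))) (Re z)
    * Derive (fun y => Im (f (Re z, y))) (Im z)
  - Derive (fun y => Re (f (Re z, y))) (Im z)
    * Derive (fun x => Im (f (x, Im z))) (Re z).

Definition sense_preserving (f : C -> C) : Prop :=
  forall z : C, in_disc z -> 0 < jacobian f z.

(** [f] is in the class H, with [f = h + conj g] on the disc, where [a] and [b]
    are the coefficients of [h] and [g].  They are determined by [f]. *)
Definition in_H_with (a b : nat -> C) (f : C -> C) : Prop :=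
  (a 0%nat = RtoC 0 /\ a 1%nat = RtoC 1 /\ analytic_coefs a) /\
  (b 0%nat = RtoC 0 /\ Cmod (b 1%nat) < 1 /\ analytic_coefs b) /\
  (forall z : C, in_disc z -> f z = harm a b z) /\
  univalent f /\ sense_preserving f.

Definition omega_coefs (nu : R) (c : nat -> C) (n : nat) : C :=
  Cmult (RtoC (Gamma (2 - nu) * Gamma (INR n + 1) / Gamma (INR n + 1 - nu)))
        (c n).

(** The value at [z] of the fractional operator applied to [h + conj g]. *)
Definition Omega (nu : R) (a b : nat -> C) : C -> C :=
  harm (omega_coefs nu a) (omega_coefs nu b).

Definition polar (r theta : R) : C := (r * cos theta, r * sin theta).

(** [m]-th partial derivative with respect to [theta] of [F (r e^(i theta))]. *)
Definition dtheta (m : nat) (F : C -> C) (r theta : R) : C :=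
  (Derive_n (fun t => Re (F (polar r t))) m theta,
   Derive_n (fun t => Im (F (polar r t))) m theta).

Definition HM_expr (lambda k : R) (F : C -> C) (r theta : R) : C :=
  (RtoC (1 - lambda) * (F (polar r theta) / polar r theta)
   + RtoC (lambda * (1 - k))
     * (dtheta 1 F r theta / dtheta 1 (fun z => z) r theta)
   + RtoC (lambda * k)
     * (dtheta 2 F r theta / dtheta 2 (fun z => z) r theta))%C.

Definition in_HM_with (beta lambda k nu : R) (a b : nat -> C) (f : C -> C)
  : Prop :=
  in_H_with a b f /\
  (forall r theta : R, 0 < r < 1 ->
     beta < Re (HM_expr lambda k (Omega nu a b) r theta)).

Definition HM (beta lambda k nu : R) (f : C -> C) : Prop :=
  exists a b : nat -> C, in_HM_with beta lambda k nu a b f.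

(** Having the coefficients [- |a_n|] ([n >= 2]) and [|b_n|] ([n >= 1]) for some
    complex [a_n], [b_n] means being equal to minus, resp. plus, one's own
    modulus. *)
Definition HMbar (beta lambda k nu : R) (f : C -> C) : Prop :=
  exists a b : nat -> C,
    in_HM_with beta lambda k nu a b f /\
    (forall n : nat, (2 <= n)%nat -> a n = RtoC (- Cmod (a n))) /\
    (forall n : nat, (1 <= n)%nat -> b n = RtoC (Cmod (b n))).

(* Main.v *)
Require Import Defs.
From Stdlib Require Import Reals Lra Lia Psatz Ranalysis5.
From Stdlib Require Import FunctionalExtensionality IndefiniteDescription.
From Coquelicot Require Import Coquelicot.

Open Scope R_scope.

(** Univalence and sense preservation are not stable under convex combinations, but for the sign
    pattern of [HMbar] they amount to a linear condition.  On the real axis the Jacobian is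
    [(h' + g') (h' - g')]; it is positive on [[0, 1)], and [h' - g'] is positive at [0], hence
    [h'(r) - g'(r) > 0] on [[0, 1)].  As all coefficients but that of [z] enter [h' - g'] with a
    negative sign, this says [sum_(n >= 2) n |a_n| r^(n-1) + sum_(n >= 1) n |b_n| r^(n-1) < 1].
    Conversely this bound gives [|f z - f w - (z - w)| < |z - w|] for [z <> w], and [|h'| > |g'|].
    It also bounds all coefficients by [1], so that every functional of the coefficients with
    absolutely summable weights commutes with the convex combination; for the inequality defining
    [HM] the weights are controlled by [Gamma (x + 1) = x Gamma x], which makes the multipliers
    of the fractional operator grow at most linearly. *)

(** * The Gamma function and the multipliers of the fractional operator *)

(** What makes the combination infinite rather than finite is a question of uniformity in [i]: each
    [f i] has its own convergent series, and sums over [i] and [n] may be interchanged only under a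
    common majorant. The bound of all coefficients by [1], obtained by letting [r] tend to [1], is
    that majorant. It reduces every interchange to the summability of weights that belong to the
    functional alone. A second obstacle is strictness: limits of partial sums keep only weak
    inequalities. It is recovered from the fact that nonnegative weights with sum [1] cannot all
    vanish. The linear condition is kept at every [r < 1] instead of at [r = 1]: a pair of points of
    the disc only sees the radius of the larger one, and there the condition says that the identity
    minus [f] is a strict contraction. [Gamma] is an improper integral, so its convergence and
    functional equation are derived here, for arguments at least [1], where the integrand stays
    bounded near [0]. *)

Lemma RInt_abs_le_primitive (f g dg : R -> R) (a b : R) :
  ex_RInt f a b ->
  (forall t, Rmin a b <= t <= Rmax a b -> is_derive g t (dg t)) ->
  (forall t, Rmin a b <= t <= Rmax a b -> continuous dg t) ->
  (forall t, Rmin a b <= t <= Rmax a b -> Rabs (f t) <= dg t) ->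
  Rabs (RInt f a b) <= Rabs (g b - g a).
Proof.
  (* The ordered case. The statement allows both orders because the Cauchy criterion for an improper
     integral compares two arbitrary endpoints. *)
  assert (main : forall a b, a <= b -> ex_RInt f a b ->
    (forall t, a <= t <= b -> is_derive g t (dg t)) ->
    (forall t, a <= t <= b -> continuous dg t) ->
    (forall t, a <= t <= b -> Rabs (f t) <= dg t) ->
    Rabs (RInt f a b) <= Rabs (g b - g a)).
  { clear a b; intros a b ab If Dg Cg le_fg.
    eapply Rle_trans; [| apply Rle_abs].
    apply (norm_RInt_le f dg a b (RInt f a b) (g b - g a) ab le_fg).
    - now apply (RInt_correct (V := R_CompleteNormedModule)).
    - apply (is_RInt_derive g dg); rewrite Rmin_left, Rmax_right by assumption; assumption. }
  intros If Dg Cg le_fg.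
  destruct (Rle_dec a b) as [ab | ba].
  - rewrite Rmin_left, Rmax_right in * by assumption; auto.
  - rewrite Rmin_right, Rmax_left in * by lra.
    rewrite <- (opp_RInt_swap (V := R_CompleteNormedModule) f) by (now apply ex_RInt_swap).
    unfold opp; simpl; rewrite Rabs_Ropp, Rabs_minus_sym.
    apply main; auto; try lra; now apply ex_RInt_swap.
Qed.

Lemma continuous_Gamma_integrand (y t : R) :
  0 < t -> continuous (fun t => Rpower t y * exp (- t)) t.
Proof.
  intros t0; apply (ex_derive_continuous (fun t => Rpower t y * exp (- t))).
  unfold Rpower; auto_derive; lra.
Qed.

Lemma ex_RInt_Gamma_integrand (y a b : R) :
  0 < a -> 0 < b -> ex_RInt (fun t => Rpower t y * exp (- t)) a b.
Proof.
  intros a0 b0; apply (ex_RInt_continuous (V := R_CompleteNormedModule)).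
  intros t [t1 _]; apply continuous_Gamma_integrand.
  eapply Rlt_le_trans; [| exact t1]; now apply Rmin_pos.
Qed.

Lemma is_lim_exp_opp_half : is_lim (fun t => exp (- (t / 2))) p_infty 0.
Proof.
  apply (is_lim_comp exp (fun t => - (t / 2)) p_infty 0 m_infty).
  - apply is_lim_exp_m.
  - apply (is_lim_ext (fun t => (- / 2) * t)).
    { intros; field. }
    evar_last; [apply is_lim_scal_l, is_lim_id |].
    simpl; destruct (Rle_dec 0 (- / 2)); [exfalso; lra | reflexivity].
  - exists 0; discriminate.
Qed.

Lemma R_ball_iff (x y e : R) : ball x e y <-> Rabs (y - x) < e.
Proof. reflexivity. Qed.

(** Half of the exponent is given up to absorb the power: [ln t / t] tends to [0], so
    [y * ln t <= t / 2] for large [t]. *)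
Lemma Gamma_integrand_tail (y : R) :
  exists T, 1 <= T /\ forall t, T <= t -> Rpower t y * exp (- t) <= exp (- (t / 2)).
Proof.
  (* Chosen so that [Rabs y] times this is at most [/ 2]; the summand [1] keeps the denominator
     positive when [y = 0]. *)
  assert (e0 : 0 < / (2 * (1 + Rabs y))).
  { apply Rinv_0_lt_compat; generalize (Rabs_pos y); lra. }
  destruct (is_lim_div_ln_p _ (locally_ball 0 (mkposreal _ e0))) as [T HT].
  exists (Rmax 1 (T + 1)); split; [apply Rmax_l |]; intros t ht.
  assert (t1 : 1 <= t) by (eapply Rle_trans; [apply Rmax_l | exact ht]).
  assert (tT : T < t) by (apply Rlt_le_trans with (T + 1); [lra |];
    eapply Rle_trans; [apply Rmax_r | exact ht]).
  specialize (HT t tT).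
  rewrite R_ball_iff, Rminus_0_r in HT; simpl in HT.
  unfold Rpower; rewrite <- exp_plus.
  assert (y * ln t <= t / 2).
  { apply Rle_trans with (Rabs y * Rabs (ln t)).
    { rewrite <- Rabs_mult; apply Rle_abs. }
    replace (Rabs (ln t)) with (Rabs (ln t / t) * t).
    2:{ unfold Rdiv; rewrite Rabs_mult, (Rabs_pos_eq (/ t)).
        - field; lra.
        - left; apply Rinv_0_lt_compat; lra. }
    assert (Rabs y * Rabs (ln t / t) <= / 2).
    { apply Rle_trans with ((1 + Rabs y) * / (2 * (1 + Rabs y))).
      - generalize (Rabs_pos y) (Rabs_pos (ln t / t)); intros; apply Rmult_le_compat; lra.
      - right; field; generalize (Rabs_pos y); lra. }
    nra. }
  destruct (Rle_lt_or_eq_dec (y * ln t + - t) (- (t / 2))) as [lt | eq]; [lra | |].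
  - left; now apply exp_increasing.
  - now right; f_equal.
Qed.

Lemma Rpower_le_1 (t y : R) : 0 < t <= 1 -> 0 <= y -> Rpower t y <= 1.
Proof.
  intros [t0 t1] y0; unfold Rpower; rewrite <- exp_0.
  assert (ln t <= 0) by (rewrite <- ln_1; now apply ln_le).
  destruct (Rle_lt_or_eq_dec (y * ln t) 0) as [lt | ->]; [nra | | lra].
  left; now apply exp_increasing.
Qed.

(** Cauchy criterion at both ends. For [0 <= y] the integrand is at most [1] on [(0, 1]], so moving
    the left endpoint costs at most the distance moved; on the right [exp (- (t / 2))] dominates. *)
Lemma ex_RInt_gen_Gamma (y : R) :
  0 <= y ->
  ex_RInt_gen (fun t => Rpower t y * exp (- t)) (at_right 0) (Rbar_locally p_infty).
Proof.
  intros y0; set (f := fun t => Rpower t y * exp (- t)).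
  destruct (Gamma_integrand_tail y) as [T [T1 HT]].
  assert (fpos : forall t, 0 <= f t).
  { intros t; left; apply Rmult_lt_0_compat; apply exp_pos. }
  apply (filterlimi_locally_cauchy (U := R_CompleteSpace)
    (F := filter_prod (at_right 0) (Rbar_locally p_infty))
    (fun ab : R * R => is_RInt f (fst ab) (snd ab))).
  { apply Filter_prod with (fun a => 0 < a) (fun b => 0 < b).
    - exists (mkposreal 1 Rlt_0_1); auto.
    - exists 0; auto.
    - intros a b a0 b0; split.
      + now apply ex_RInt_Gamma_integrand.
      + intros l1 l2 I1 I2.
        rewrite <- (is_RInt_unique (V := R_CompleteNormedModule) _ _ _ _ I1).
        apply (is_RInt_unique (V := R_CompleteNormedModule) _ _ _ _ I2). }
  intros eps.
  assert (Blim : Rbar_locally p_infty (fun b => T < b /\ exp (- (b / 2)) < eps / 8)).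
  { apply filter_and; [now exists T |].
    assert (e8 : 0 < eps / 8) by (generalize (cond_pos eps); lra).
    destruct (is_lim_exp_opp_half _ (locally_ball 0 (mkposreal _ e8))) as [M HM].
    exists M; intros b Mb; specialize (HM b Mb).
    rewrite R_ball_iff, Rminus_0_r in HM; simpl in HM; eapply Rle_lt_trans; [apply Rle_abs | exact HM]. }
  (* The left ends contribute less than [eps / 4]. At the right, the primitive
     [-2 * exp (- (t / 2))] of the majorant doubles the bound [eps / 8]. *)
  exists (fun ab => (0 < fst ab /\ fst ab < Rmin 1 (eps / 4)) /\
                    (T < snd ab /\ exp (- (snd ab / 2)) < eps / 8)).
  split.
  { refine (Filter_prod _ _ _ (fun a => 0 < a /\ a < Rmin 1 (eps / 4)) _ _ Blim _).
    - assert (e0 : 0 < Rmin 1 (eps / 4))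
        by (apply Rmin_pos; generalize (cond_pos eps); lra).
      exists (mkposreal _ e0); intros a ha a0; split; [exact a0 |].
      rewrite R_ball_iff, Rminus_0_r in ha; simpl in ha; eapply Rle_lt_trans; [apply Rle_abs | exact ha].
    - auto. }
  intros [a b] [a' b'] [[a0 a1] [b0 b1]] [[a0' a1'] [b0' b1']] u v Iu Iv; simpl in *.
  assert (m1 := Rmin_l 1 (eps / 4)); assert (m2 := Rmin_r 1 (eps / 4)).
  assert (Ex : forall c d, 0 < c -> 0 < d -> ex_RInt f c d)
    by (intros; now apply ex_RInt_Gamma_integrand).
  assert (A : Rabs (RInt f a a') <= Rabs (a' - a)).
  { apply (RInt_abs_le_primitive f (fun t => t) (fun _ => 1)); [apply Ex; lra | | |].
    - intros; apply (is_derive_id (K := R_AbsRing)).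
    - intros; apply continuous_const.
    - intros t [ht1 ht2]; rewrite Rabs_pos_eq by apply fpos.
      assert (0 < t) by (eapply Rlt_le_trans; [| exact ht1]; now apply Rmin_pos).
      assert (t <= 1) by (eapply Rle_trans; [exact ht2 |]; apply Rmax_lub; lra).
      assert (Rpower t y <= 1) by (apply Rpower_le_1; lra).
      assert (exp (- t) <= 1) by (rewrite <- exp_0; left; apply exp_increasing; lra).
      unfold f; generalize (exp_pos (- t)) (exp_pos (y * ln t)); unfold Rpower in *; intros; nra. }
  assert (B : Rabs (RInt f b' b) <= Rabs (-2 * exp (- (b / 2)) - -2 * exp (- (b' / 2)))).
  { apply (RInt_abs_le_primitive f (fun t => -2 * exp (- (t / 2))) (fun t => exp (- (t / 2))));
      [apply Ex; lra | | |].
    - intros; auto_derive; [auto | unfold Rdiv; field].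
    - intros; apply (ex_derive_continuous (fun t => exp (- (t / 2)))); auto_derive; auto.
    - intros t [ht1 _]; rewrite Rabs_pos_eq by apply fpos; apply HT.
      eapply Rle_trans; [| exact ht1]; apply Rmin_glb; lra. }
  assert (E : u = RInt f a a' + v + RInt f b' b).
  { apply (is_RInt_unique (V := R_CompleteNormedModule)) in Iu, Iv.
    rewrite <- Iu, <- Iv.
    generalize (RInt_Chasles f a a' b' (Ex a a' a0 a0') (Ex a' b' a0' ltac:(lra))).
    generalize (RInt_Chasles f a b' b (Ex a b' a0 ltac:(lra)) (Ex b' b ltac:(lra) ltac:(lra))).
    unfold plus; simpl; intros <- <-; reflexivity. }
  apply R_ball_iff.
  replace (v - u) with (- (RInt f a a' + RInt f b' b)) by (rewrite E; ring).
  rewrite Rabs_Ropp; eapply Rle_lt_trans; [apply Rabs_triang |].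
  generalize (exp_pos (- (b / 2))) (exp_pos (- (b' / 2))) (cond_pos eps); intros.
  assert (Rabs (a' - a) < eps / 4) by (apply Rabs_def1; lra).
  assert (Rabs (-2 * exp (- (b / 2)) - -2 * exp (- (b' / 2))) < eps / 2) by (apply Rabs_def1; lra).
  lra.
Qed.

(** Integration by parts: the integrand [g] of [Gamma (x + 1)] has derivative [x * f - g], with [f]
    the integrand of [Gamma x], and [g] vanishes at both ends. *)
Lemma Gamma_succ (x : R) : 1 <= x -> Gamma (x + 1) = x * Gamma x.
Proof.
  intros x1.
  set (g := fun t => Rpower t x * exp (- t)).
  set (f := fun t => Rpower t (x - 1) * exp (- t)).
  assert (E : forall t, 0 < t -> Rpower t x = Rpower t (x - 1) * t).
  { intros t t0; rewrite <- (Rpower_1 t) at 3 by assumption.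
    rewrite <- Rpower_plus; f_equal; ring. }
  assert (Dg : forall t, 0 < t -> is_derive g t (x * f t - g t)).
  { intros t t0; unfold g, f.
    evar_last.
    - unfold Rpower; auto_derive; [exact t0 | reflexivity].
    - change (exp (x * ln t)) with (Rpower t x); rewrite E by assumption; field; lra. }
  assert (pos : filter_prod (at_right 0) (Rbar_locally p_infty) (fun ab : R * R =>
     forall t, Rmin (fst ab) (snd ab) <= t <= Rmax (fst ab) (snd ab) -> 0 < t)).
  { apply Filter_prod with (fun a => 0 < a) (fun b => 0 < b).
    - exists (mkposreal 1 Rlt_0_1); auto.
    - exists 0; auto.
    - intros a b a0 b0 t [ht _]; eapply Rlt_le_trans; [| exact ht]; now apply Rmin_pos. }
  assert (Lim0 : filterlim g (at_right 0) (locally 0)).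
  { apply filterlim_locally; intros eps.
    exists (mkposreal _ (Rmin_pos _ _ Rlt_0_1 (cond_pos eps))); intros t ht t0.
    rewrite R_ball_iff, Rminus_0_r in *; simpl in ht; rewrite Rabs_pos_eq in ht by lra.
    assert (m1 := Rmin_l 1 eps); assert (m2 := Rmin_r 1 eps).
    assert (Rpower t (x - 1) <= 1) by (apply Rpower_le_1; lra).
    assert (exp (- t) <= 1) by (rewrite <- exp_0; left; apply exp_increasing; lra).
    assert (p1 := exp_pos (- t)); assert (p2 : 0 < Rpower t (x - 1)) by apply exp_pos.
    unfold g; rewrite E by assumption.
    rewrite Rabs_pos_eq by (repeat apply Rmult_le_pos; lra).
    assert (Rpower t (x - 1) * exp (- t) <= 1) by nra.
    apply Rle_lt_trans with t; [nra | lra]. }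
  assert (Lim1 : filterlim g (Rbar_locally p_infty) (locally 0)).
  { destruct (Gamma_integrand_tail x) as [T [T1 HT]].
    apply (filterlim_le_le (F := Rbar_locally p_infty) (fun _ => 0) g (fun t => exp (- (t / 2))) 0).
    - exists T; intros t Tt; split.
      + left; apply Rmult_lt_0_compat; apply exp_pos.
      + apply HT; lra.
    - apply filterlim_const.
    - apply is_lim_exp_opp_half. }
  assert (I0 : is_RInt_gen (Derive g) (at_right 0) (Rbar_locally p_infty) (0 - 0)).
  { apply is_RInt_gen_Derive; try assumption.
    - revert pos; apply filter_imp; intros ab H t ht; eexists; apply Dg, H, ht.
    - revert pos; apply filter_imp; intros ab H t ht.
      (* The formula for [Derive g] is available for positive arguments only, hence on the ball of
         radius [t] around [t]. *)
      apply (continuous_ext_loc _ (fun t => x * f t - g t)).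
      { exists (mkposreal t (H t ht)); intros s hs; symmetry; apply is_derive_unique, Dg.
        rewrite R_ball_iff in hs; simpl in hs.
        apply Rabs_def2 in hs; lra. }
      apply (continuous_minus (fun t => x * f t) g).
      + apply (continuous_scal_r x f), continuous_Gamma_integrand, H, ht.
      + apply continuous_Gamma_integrand, H, ht. }
  assert (If : is_RInt_gen f (at_right 0) (Rbar_locally p_infty) (Gamma x)).
  { apply (RInt_gen_correct (V := R_CompleteNormedModule)), ex_RInt_gen_Gamma; lra. }
  unfold Gamma at 1; apply (is_RInt_gen_unique (V := R_CompleteNormedModule)).
  replace (x + 1 - 1) with x by ring.
  replace (x * Gamma x) with (x * Gamma x + -1 * (0 - 0)) by ring.
  eapply (is_RInt_gen_ext (fun t => x * f t + -1 * Derive g t)).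
  - revert pos; apply filter_imp; intros ab H t ht.
    change (x * f t + -1 * Derive g t = g t).
    rewrite (is_derive_unique g t _ (Dg t (H t ltac:(lra)))); ring.
  - apply (is_RInt_gen_plus (fun t => x * f t) (fun t => -1 * Derive g t)).
    + now apply (is_RInt_gen_scal f x).
    + now apply (is_RInt_gen_scal (Derive g) (-1)).
Qed.

Definition omega_mult (nu : R) (n : nat) : R :=
  Gamma (2 - nu) * Gamma (INR n + 1) / Gamma (INR n + 1 - nu).

(* By [Gamma_succ] consecutive multipliers have ratio [(n + 1) / (n + 1 - nu)], which is at
   most [(n + 1) / n]. *)
Lemma omega_mult_bound (nu : R) :
  0 <= nu < 1 ->
  exists C, 0 <= C /\ forall n, Rabs (omega_mult nu n) <= C * (INR n + 1).
Proof.
  intros hnu.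
  assert (main : forall n, Rabs (omega_mult nu (S n)) <= Rabs (omega_mult nu 1) * INR (S n)).
  { induction n as [| n IH]; [simpl; lra |].
    assert (n0 := pos_INR n).
    assert (E : omega_mult nu (S (S n)) = omega_mult nu (S n) * ((INR n + 2) / (INR n + 2 - nu))).
    { unfold omega_mult; rewrite !S_INR.
      rewrite (Gamma_succ (INR n + 1 + 1)) by lra.
      replace (INR n + 1 + 1 + 1 - nu) with ((INR n + 1 + 1 - nu) + 1) by ring.
      rewrite (Gamma_succ (INR n + 1 + 1 - nu)) by lra.
      unfold Rdiv; rewrite Rinv_mult.
      replace (INR n + 2) with (INR n + 1 + 1) by ring; ring. }
    rewrite E, Rabs_mult, (Rabs_pos_eq (_ / _)).
    2:{ apply Rmult_le_pos; [lra | left; apply Rinv_0_lt_compat; lra]. }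
    apply Rle_trans with (Rabs (omega_mult nu 1) * INR (S n) * ((INR n + 2) / (INR n + 1))).
    - apply Rmult_le_compat; try assumption.
      + apply Rabs_pos.
      + apply Rmult_le_pos; [lra | left; apply Rinv_0_lt_compat; lra].
      + apply Rmult_le_compat_l; [lra |]; apply Rinv_le_contravar; lra.
    - right; rewrite !S_INR; field; lra. }
  assert (p0 := Rabs_pos (omega_mult nu 0)); assert (p1 := Rabs_pos (omega_mult nu 1)).
  (* The multiplier of index [0] involves [Gamma (1 - nu)], below the range of [Gamma_succ] unless
     [nu = 0]; its modulus is simply added to the constant. *)
  exists (Rabs (omega_mult nu 0) + Rabs (omega_mult nu 1)); split; [lra |].
  intros [| n]; [simpl; lra |].
  assert (n0 := pos_INR (S n)); specialize (main n); nra.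
Qed.

(** * Power series with real coefficients on the unit disc *)

Lemma is_series_le (a b : nat -> R) (la lb : R) :
  (forall n, a n <= b n) -> is_series a la -> is_series b lb -> la <= lb.
Proof.
  intros ab Ha Hb.
  apply (is_lim_seq_le (sum_n a) (sum_n b) la lb); [| exact Ha | exact Hb].
  intros n; apply sum_n_m_le, ab.
Qed.

Lemma is_series_term_le (a : nat -> R) (l : R) (n : nat) :
  (forall k, 0 <= a k) -> is_series a l -> a n <= l.
Proof.
  intros a0 Ha.
  assert (mono : forall k, sum_n a k <= sum_n a (S k)).
  { intros k; rewrite sum_Sn; unfold plus; simpl; specialize (a0 (S k)); lra. }
  apply Rle_trans with (sum_n a n); [| now apply (is_lim_seq_incr_compare (sum_n a) l Ha mono)].
  destruct n as [| n]; [rewrite sum_O; lra |].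
  rewrite sum_Sn; unfold plus; simpl.
  enough (0 <= sum_n a n) by lra.
  induction n as [| n IH]; [rewrite sum_O; apply a0 | specialize (mono n); lra].
Qed.

Lemma ex_series_Rmult_l (c : R) (a : nat -> R) :
  ex_series a -> ex_series (fun n => c * a n).
Proof. exact (ex_series_scal_l (V := R_NormedModule) c a). Qed.

Lemma ex_series_dominated (a b : nat -> R) (M : R) :
  (forall n, Rabs (a n) <= M * b n) -> ex_series b -> ex_series a.
Proof.
  intros ab Hb; apply (ex_series_le (V := R_CompleteNormedModule) a (fun n => M * b n) ab).
  now apply (ex_series_Rmult_l M).
Qed.

(** Convergence is asked in absolute form so that it passes to dominated sequences;
    [analytic_coefs_RtoC] shows that it is the same as analyticity on the disc. *)
Definition conv_disc (c : nat -> R) : Prop :=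
  forall r, 0 <= r < 1 -> ex_series (fun n => Rabs (c n) * r ^ n).

Lemma conv_disc_dominated (c d : nat -> R) (M : R) :
  (forall n, Rabs (c n) <= M * Rabs (d n)) -> conv_disc d -> conv_disc c.
Proof.
  intros cd Hd r hr; apply (ex_series_dominated _ (fun n => Rabs (d n) * r ^ n) M); [| now apply Hd].
  intros n; assert (0 <= r ^ n) by (apply pow_le; lra).
  rewrite Rabs_mult, Rabs_Rabsolu, (Rabs_pos_eq (r ^ n)), <- Rmult_assoc by assumption.
  now apply Rmult_le_compat_r.
Qed.

Lemma conv_disc_bounded (c : nat -> R) (M : R) :
  (forall n, Rabs (c n) <= M) -> conv_disc c.
Proof.
  intros cM; apply (conv_disc_dominated c (fun _ => 1) M).
  - intros n; rewrite Rabs_R1, Rmult_1_r; apply cM.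
  - intros r hr; apply (ex_series_ext (fun n => r ^ n)).
    + intros n; now rewrite Rabs_R1, Rmult_1_l.
    + apply ex_series_geom; rewrite Rabs_pos_eq; lra.
Qed.

Lemma conv_disc_plus (c d : nat -> R) :
  conv_disc c -> conv_disc d -> conv_disc (fun n => c n + d n).
Proof.
  intros Hc Hd r hr.
  apply (ex_series_dominated _ (fun n => Rabs (c n) * r ^ n + Rabs (d n) * r ^ n) 1).
  - intros n; assert (0 <= r ^ n) by (apply pow_le; lra).
    rewrite Rabs_mult, Rabs_Rabsolu, (Rabs_pos_eq (r ^ n)) by assumption.
    generalize (Rabs_triang (c n) (d n)); nra.
  - exact (ex_series_plus _ _ (Hc r hr) (Hd r hr)).
Qed.

Lemma conv_disc_minus (c d : nat -> R) :
  conv_disc c -> conv_disc d -> conv_disc (fun n => c n - d n).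
Proof.
  intros Hc Hd; apply (conv_disc_plus c (fun n => - d n) Hc).
  apply (conv_disc_dominated _ d 1); [| exact Hd].
  intros n; rewrite Rabs_Ropp; lra.
Qed.

Lemma conv_disc_CV_radius (c : nat -> R) (r : R) :
  conv_disc c -> 0 <= r < 1 -> Rbar_lt r (CV_radius c).
Proof.
  (* Bounded terms at a point give only a weak lower bound on the radius of convergence; the
     midpoint of [r] and [1] makes it strict. *)
  intros Hc hr; apply Rbar_lt_le_trans with ((1 + r) / 2); [simpl; lra |].
  apply CV_radius_bounded.
  destruct (Hc ((1 + r) / 2) ltac:(lra)) as [l Hl].
  exists l; intros n.
  assert (pw : forall k, 0 <= ((1 + r) / 2) ^ k) by (intros; apply pow_le; lra).
  rewrite Rabs_mult, (Rabs_pos_eq (_ ^ n)) by apply pw.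
  apply (is_series_term_le (fun n => Rabs (c n) * ((1 + r) / 2) ^ n)); [| exact Hl].
  intros k; apply Rmult_le_pos; [apply Rabs_pos | apply pw].
Qed.

(** Differentiation keeps the radius of convergence, and [PS_incr_1] multiplies the derivative by
    the variable, which brings the index back to [n]. *)
Lemma conv_disc_INR (c : nat -> R) :
  conv_disc c -> conv_disc (fun n => INR n * c n).
Proof.
  intros Hc r hr.
  assert (D : ex_series (fun n => Rabs (PS_incr_1 (PS_derive c) n * r ^ n))).
  { apply CV_disk_inside; rewrite CV_radius_incr_1, CV_radius_derive, Rabs_pos_eq by lra.
    now apply conv_disc_CV_radius. }
  revert D; apply ex_series_ext; intros n.
  rewrite Rabs_mult, (Rabs_pos_eq (r ^ n)) by (apply pow_le; lra).
  destruct n as [| n]; simpl; [| reflexivity].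
  change (Rabs 0 * 1 = Rabs (0 * c 0%nat) * 1); now rewrite Rmult_0_l.
Qed.

Lemma is_series_C (a : nat -> C) (l : C) :
  is_series a l <->
  is_series (fun n => Re (a n)) (Re l) /\ is_series (fun n => Im (a n)) (Im l).
Proof.
  assert (SRe : forall n, sum_n (fun n => Re (a n)) n = Re (sum_n a n)).
  { induction n as [| n IH]; [now rewrite !sum_O | rewrite !sum_Sn, IH; reflexivity]. }
  assert (SIm : forall n, sum_n (fun n => Im (a n)) n = Im (sum_n a n)).
  { induction n as [| n IH]; [now rewrite !sum_O | rewrite !sum_Sn, IH; reflexivity]. }
  unfold is_series; split.
  - intros H; split; apply filterlim_locally; intros eps;
      generalize (proj1 (filterlim_locally _ _) H eps); apply filter_imp; intros n [B1 B2];
      [rewrite SRe | rewrite SIm]; assumption.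
  - intros [H1 H2]; apply filterlim_locally; intros eps.
    generalize (filter_and _ _ (proj1 (filterlim_locally _ _) H1 eps)
      (proj1 (filterlim_locally _ _) H2 eps)); apply filter_imp; intros n [B1 B2].
    rewrite SRe in B1; rewrite SIm in B2; now split.
Qed.

Lemma pow_n_Cpow (z : C) (n : nat) : pow_n (K := C_Ring) z n = (z ^ n)%C.
Proof. induction n as [| n IH]; [reflexivity | simpl; now rewrite IH]. Qed.

Lemma Re_pseries_term (z : C) (n : nat) (x : R) :
  Re (scal (K := C_AbsRing) (V := C_NormedModule) (pow_n z n) (RtoC x)) = x * Re (z ^ n)%C.
Proof.
  change (Re (pow_n (K := C_Ring) z n * RtoC x)%C = x * Re (z ^ n)%C).
  rewrite pow_n_Cpow; destruct (z ^ n)%C; unfold Re; simpl; ring.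
Qed.

Lemma Im_pseries_term (z : C) (n : nat) (x : R) :
  Im (scal (K := C_AbsRing) (V := C_NormedModule) (pow_n z n) (RtoC x)) = x * Im (z ^ n)%C.
Proof.
  change (Im (pow_n (K := C_Ring) z n * RtoC x)%C = x * Im (z ^ n)%C).
  rewrite pow_n_Cpow; destruct (z ^ n)%C; unfold Im; simpl; ring.
Qed.

Lemma is_pseries_RtoC (c : nat -> R) (z s : C) :
  is_pseries (fun n => RtoC (c n)) z s <->
  is_series (fun n => c n * Re (z ^ n)%C) (Re s) /\
  is_series (fun n => c n * Im (z ^ n)%C) (Im s).
Proof.
  unfold is_pseries; rewrite is_series_C.
  split; intros [H1 H2]; split; [revert H1 | revert H2 | revert H1 | revert H2];
    apply is_series_ext; intros n.
  - apply Re_pseries_term.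
  - apply Im_pseries_term.
  - symmetry; apply Re_pseries_term.
  - symmetry; apply Im_pseries_term.
Qed.

Lemma im_le_Cmod (z : C) : Rabs (Im z) <= Cmod z.
Proof. eapply Rle_trans; [apply Rmax_r | apply Rmax_Cmod]. Qed.

Lemma ex_series_Cpow (L : C -> R) (c : nat -> R) (z : C) :
  (forall w, Rabs (L w) <= Cmod w) -> conv_disc c -> in_disc z ->
  ex_series (fun n => c n * L (z ^ n)%C).
Proof.
  intros HL Hc hz.
  apply (ex_series_dominated _ (fun n => Rabs (c n) * Cmod z ^ n) 1).
  - intros n; rewrite Rabs_mult, Rmult_1_l; apply Rmult_le_compat_l; [apply Rabs_pos |].
    rewrite <- Cmod_pow; apply HL.
  - apply Hc; split; [apply Cmod_ge_0 | exact hz].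
Qed.

(** Abel's lemma: convergence at the real point [(1 + r) / 2] bounds the terms there, which forces
    absolute convergence at the smaller radius [r]. *)
Lemma analytic_coefs_RtoC (c : nat -> R) :
  analytic_coefs (fun n => RtoC (c n)) <-> conv_disc c.
Proof.
  split.
  - intros Hc r hr.
    assert (hr' : in_disc (RtoC ((1 + r) / 2))).
    { unfold in_disc; rewrite Cmod_R, Rabs_pos_eq; lra. }
    destruct (Hc _ hr') as [s Hs]; apply is_pseries_RtoC in Hs; destruct Hs as [Hs _].
    apply (ex_series_ext (fun n => Rabs (c n * r ^ n))).
    { intros n; now rewrite Rabs_mult, (Rabs_pos_eq (r ^ n)) by (apply pow_le; lra). }
    apply CV_disk_inside; rewrite Rabs_pos_eq by lra.
    apply Rbar_lt_le_trans with ((1 + r) / 2); [simpl; lra |].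
    apply CV_radius_bounded.
    assert (L : is_lim_seq (fun n => c n * ((1 + r) / 2) ^ n) 0).
    { apply ex_series_lim_0; exists (Re s); revert Hs; apply is_series_ext; intros n.
      now rewrite <- RtoC_pow. }
    destruct (filterlim_bounded _ (ex_intro _ 0 L)) as [M HM].
    exists M; exact HM.
  - intros Hc z hz.
    destruct (ex_series_Cpow Re c z re_le_Cmod Hc hz) as [s1 H1].
    destruct (ex_series_Cpow Im c z im_le_Cmod Hc hz) as [s2 H2].
    exists (s1, s2); now apply is_pseries_RtoC.
Qed.

Lemma CPSeries_RtoC (c : nat -> R) (z : C) :
  conv_disc c -> in_disc z ->
  CPSeries (fun n => RtoC (c n)) z =
  (Series (fun n => c n * Re (z ^ n)%C), Series (fun n => c n * Im (z ^ n)%C)).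
Proof.
  intros Hc hz; unfold CPSeries; apply (iota_unique (V := C_CompleteNormedModule)).
  - intros s Hs; apply is_pseries_RtoC in Hs; destruct Hs as [H1 H2].
    apply is_series_unique in H1, H2.
    rewrite H1, H2; apply surjective_pairing.
  - apply is_pseries_RtoC; split; apply Series_correct; apply ex_series_Cpow;
      auto using re_le_Cmod, im_le_Cmod.
Qed.

(** Conjugation changes the sign of the imaginary part only, so with real coefficients the real part
    sees [u + v] and the imaginary part [u - v]. Most later computations split along this line. *)
Lemma harm_RtoC (u v : nat -> R) (z : C) :
  conv_disc u -> conv_disc v -> in_disc z ->
  harm (fun n => RtoC (u n)) (fun n => RtoC (v n)) z =
  (Series (fun n => (u n + v n) * Re (z ^ n)%C), Series (fun n => (u n - v n) * Im (z ^ n)%C)).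
Proof.
  intros Hu Hv hz; unfold harm; rewrite !CPSeries_RtoC by assumption.
  unfold Cplus, Cconj; simpl; f_equal.
  - rewrite <- Series_plus by (apply ex_series_Cpow; auto using re_le_Cmod).
    apply Series_ext; intros; ring.
  - change (Series (fun n => u n * Im (z ^ n)%C) - Series (fun n => v n * Im (z ^ n)%C) =
            Series (fun n => (u n - v n) * Im (z ^ n)%C)).
    rewrite <- Series_minus by (apply ex_series_Cpow; auto using im_le_Cmod).
    apply Series_ext; intros; ring.
Qed.

(** Triangle inequality for a complex series given by its two real parts: project every term on the
    direction of the sum, by multiplying with [Cconj (x n, y n)], sum the real inequalities, and
    divide by [Cmod (X, Y)]. *)
Lemma Cmod_is_series_le (x y m : nat -> R) (X Y M : R) :
  (forall n, Cmod (x n, y n) <= m n) ->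
  is_series x X -> is_series y Y -> is_series m M -> Cmod (X, Y) <= M.
Proof.
  intros H HX HY HM.
  assert (C0 := Cmod_ge_0 (X, Y)).
  assert (S1 : is_series (fun n => X * x n + Y * y n) (X * X + Y * Y)).
  { exact (is_series_plus _ _ _ _ (is_series_scal_l X x X HX) (is_series_scal_l Y y Y HY)). }
  assert (S2 : is_series (fun n => Cmod (X, Y) * m n) (Cmod (X, Y) * M)).
  { exact (is_series_scal_l (Cmod (X, Y)) m M HM). }
  assert (le : X * X + Y * Y <= Cmod (X, Y) * M).
  { refine (is_series_le _ _ _ _ (fun n => _) S1 S2).
    apply Rle_trans with (Cmod (X, Y) * Cmod (x n, y n)); [| now apply Rmult_le_compat_l].
    rewrite <- (Cmod_conj (x n, y n)), <- Cmod_mult.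
    eapply Rle_trans; [| eapply Rle_trans; [apply Rle_abs | apply re_le_Cmod]].
    unfold Cmult, Cconj, Re; simpl; lra. }
  assert (E := Cmod2_alt (X, Y)); unfold Re, Im in E; simpl in E.
  destruct (Req_dec (Cmod (X, Y)) 0) as [Z | NZ].
  - rewrite Z; apply (is_series_le (fun _ => 0) m 0 M).
    + intros n; eapply Rle_trans; [apply Cmod_ge_0 | apply H].
    + apply is_series_Reals; intros eps he; exists 0%nat; intros n _.
      rewrite sum_eq_R0 by auto; unfold Rdist; now rewrite Rminus_0_r, Rabs_R0.
    + exact HM.
  - apply Rmult_le_reg_l with (Cmod (X, Y)); nra.
Qed.

(** A quadratic Taylor remainder with summable constants [M] takes the place of uniform convergence
    of the derivatives: the error of the difference quotient at step [h] is at most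
    [Rabs h * Series M]. *)
Lemma is_derive_Series (u : nat -> R -> R) (du M : nat -> R) (x d : R) :
  0 < d -> ex_series M -> ex_series du ->
  (forall y, Rabs (y - x) < d -> ex_series (fun n => u n y)) ->
  (forall n y, Rabs (y - x) < d ->
     Rabs (u n y - u n x - (y - x) * du n) <= M n * (y - x) ^ 2) ->
  is_derive (fun y => Series (fun n => u n y)) x (Series du).
Proof.
  intros d0 HM Hdu Hu H; apply is_derive_Reals; intros eps he.
  assert (K0 : 0 < 1 + Rabs (Series M)) by (generalize (Rabs_pos (Series M)); lra).
  assert (del : 0 < Rmin d (eps / (1 + Rabs (Series M)))).
  { apply Rmin_pos; [exact d0 | now apply Rdiv_lt_0_compat]. }
  exists (mkposreal _ del); intros h h0 hd; simpl in hd.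
  assert (hd1 : Rabs h < d) by (eapply Rlt_le_trans; [exact hd | apply Rmin_l]).
  assert (hd2 : Rabs h < eps / (1 + Rabs (Series M)))
    by (eapply Rlt_le_trans; [exact hd | apply Rmin_r]).
  assert (Ux : ex_series (fun n => u n x)).
  { apply Hu; now rewrite Rminus_diag, Rabs_R0. }
  assert (Uy : ex_series (fun n => u n (x + h))).
  { apply Hu; now replace (x + h - x) with h by ring. }
  assert (E : Series (fun n => u n (x + h)) - Series (fun n => u n x) - h * Series du =
              Series (fun n => u n (x + h) - u n x - h * du n)).
  { rewrite (Series_minus (fun n => u n (x + h) - u n x) (fun n => h * du n)).
    - now rewrite Series_minus, Series_scal_l by assumption.
    - exact (ex_series_minus _ _ Uy Ux).
    - now apply (ex_series_Rmult_l h). }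
  assert (B : forall n, Rabs (u n (x + h) - u n x - h * du n) <= h ^ 2 * M n).
  { intros n; specialize (H n (x + h)); replace (x + h - x) with h in H by ring.
    now rewrite (Rmult_comm (h ^ 2)); apply H. }
  assert (le : Rabs (Series (fun n => u n (x + h)) - Series (fun n => u n x) - h * Series du)
               <= h ^ 2 * Series M).
  { rewrite E, <- Series_scal_l.
    eapply Rle_trans; [apply Series_Rabs |].
    - apply (ex_series_dominated _ M (h ^ 2)); [| exact HM].
      intros n; rewrite Rabs_Rabsolu; apply B.
    - apply Series_le; [| now apply (ex_series_Rmult_l (h ^ 2))].
      intros n; split; [apply Rabs_pos | apply B]. }
  replace ((Series (fun n => u n (x + h)) - Series (fun n => u n x)) / h - Series du)
    with ((Series (fun n => u n (x + h)) - Series (fun n => u n x) - h * Series du) / h)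
    by (field; exact h0).
  unfold Rdiv; rewrite Rabs_mult, Rabs_inv.
  assert (ah : 0 < Rabs h) by now apply Rabs_pos_lt.
  apply Rmult_lt_reg_r with (Rabs h); [exact ah |].
  rewrite Rmult_assoc, Rinv_l, Rmult_1_r by lra.
  apply Rle_lt_trans with (Rabs h * (Rabs h * (1 + Rabs (Series M)))).
  - eapply Rle_trans; [exact le |].
    rewrite <- (pow2_abs h).
    generalize (Rle_abs (Series M)); intros; nra.
  - rewrite (Rmult_comm eps); apply Rmult_lt_compat_l; [exact ah |].
    apply Rmult_lt_reg_r with (/ (1 + Rabs (Series M))); [now apply Rinv_0_lt_compat |].
    rewrite Rmult_assoc, Rinv_r, Rmult_1_r by lra; exact hd2.
Qed.

(* The weights [w] do not depend on [i]; this is the form in which every linear functional of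
   the coefficients is passed through the infinite convex combination. *)
Lemma is_series_exchange (t : nat -> R) (T M : R) (w : nat -> R) (c : nat -> nat -> R) :
  (forall i, 0 <= t i) -> is_series t T ->
  ex_series (fun n => Rabs (w n)) -> (forall i n, Rabs (c i n) <= M) ->
  is_series (fun i => t i * Series (fun n => w n * c i n))
    (Series (fun n => w n * Series (fun i => t i * c i n))).
Proof.
  intros t0 HT Hw HM.
  assert (M0 : 0 <= M) by (eapply Rle_trans; [apply Rabs_pos | apply (HM 0%nat 0%nat)]).
  assert (Hc : forall n, ex_series (fun i => t i * c i n)).
  { intros n; apply (ex_series_dominated _ t M); [| now exists T].
    intros i; rewrite Rabs_mult, Rabs_pos_eq, Rmult_comm by apply t0.
    apply Rmult_le_compat_r; auto. }
  (* This bound does not depend on [n]. It lets the interchange for partial sums, which is mere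
     linearity ([fin]), survive the limit: the error is at most the sum of [Rabs (w n)] times it. *)
  assert (tail : forall N n, Rabs (Series (fun i => t i * c i n) - sum_n (fun i => t i * c i n) N)
                           <= M * (T - sum_n t N)).
  { intros N n.
    assert (Ht : ex_series t) by now exists T.
    rewrite <- (is_series_unique t T HT).
    rewrite (Series_incr_n _ (S N) ltac:(lia) (Hc n)), (Series_incr_n t (S N) ltac:(lia) Ht).
    rewrite !sum_n_Reals; simpl pred.
    match goal with |- Rabs (?p + ?q - ?p) <= _ => replace (p + q - p) with q by ring end.
    match goal with |- _ <= M * (?p + ?q - ?p) => replace (p + q - p) with q by ring end.
    rewrite <- Series_scal_l.
    assert (B : forall k, Rabs (t (S N + k)%nat * c (S N + k)%nat n) <= M * t (S N + k)%nat).
    { intros i; rewrite Rabs_mult, Rabs_pos_eq, Rmult_comm by apply t0.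
      apply Rmult_le_compat_r; auto. }
    assert (Ht' : ex_series (fun k => t (S N + k)%nat)) by now apply (ex_series_incr_n t).
    eapply Rle_trans; [apply Series_Rabs |].
    - apply (ex_series_dominated _ (fun k => t (S N + k)%nat) M); [| exact Ht'].
      intros k; rewrite Rabs_Rabsolu; apply B.
    - apply Series_le; [| now apply (ex_series_Rmult_l M)].
      intros k; split; [apply Rabs_pos | apply B]. }
  assert (wc : forall g K, (forall n, Rabs (g n) <= K) -> ex_series (fun n => Rabs (w n * g n))).
  { intros g K HK; apply (ex_series_dominated _ (fun n => Rabs (w n)) K); [| exact Hw].
    intros n; rewrite Rabs_Rabsolu, Rabs_mult, Rmult_comm.
    apply Rmult_le_compat_r; [apply Rabs_pos | apply HK]. }
  assert (bound : forall N n, Rabs (sum_n (fun i => t i * c i n) N) <= M * sum_n t N).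
  { intros N n; induction N as [| N IH].
    - rewrite !sum_O, Rabs_mult, Rabs_pos_eq, Rmult_comm by apply t0.
      apply Rmult_le_compat_r; auto.
    - rewrite !sum_Sn; unfold plus; simpl.
      eapply Rle_trans; [apply Rabs_triang |].
      rewrite Rabs_mult, (Rabs_pos_eq (t (S N))) by apply t0.
      generalize (t0 (S N)) (HM (S N) n); nra. }
  assert (fin : forall N, sum_n (fun i => t i * Series (fun n => w n * c i n)) N =
                          Series (fun n => w n * sum_n (fun i => t i * c i n) N)).
  { induction N as [| N IH].
    - rewrite sum_O, <- Series_scal_l; apply Series_ext; intros n; rewrite sum_O; ring.
    - rewrite sum_Sn, IH, <- Series_scal_l; unfold plus; simpl.
      rewrite <- Series_plus.
      + apply Series_ext; intros n; rewrite sum_Sn; unfold plus; simpl; ring.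
      + apply ex_series_Rabs, (wc _ (M * sum_n t N)); intros; apply bound.
      + apply (ex_series_Rmult_l (t (S N))), ex_series_Rabs, (wc _ M); intros; apply HM. }
  assert (lim : is_lim_seq (fun N => Series (fun n => Rabs (w n)) * M * (T - sum_n t N)) 0).
  { apply (is_lim_seq_ext (fun N => Series (fun n => Rabs (w n)) * M * T
      - Series (fun n => Rabs (w n)) * M * sum_n t N)); [intros; ring |].
    replace (Finite 0) with (Finite (Series (fun n => Rabs (w n)) * M * T
      - Series (fun n => Rabs (w n)) * M * T)) by (f_equal; ring).
    apply (is_lim_seq_minus' _ _ _ _ (is_lim_seq_const _)).
    apply (is_lim_seq_scal_l (sum_n t) _ T); exact HT. }
  change (is_lim_seq (sum_n (fun i => t i * Series (fun n => w n * c i n)))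
    (Series (fun n => w n * Series (fun i => t i * c i n)))).
  set (L := Series (fun n => w n * Series (fun i => t i * c i n))).
  apply (is_lim_seq_le_le
    (fun N => L - Series (fun n => Rabs (w n)) * M * (T - sum_n t N)) _
    (fun N => L + Series (fun n => Rabs (w n)) * M * (T - sum_n t N))).
  - intros N; rewrite fin.
    assert (exL : ex_series (fun n => w n * Series (fun i => t i * c i n))).
    { apply ex_series_Rabs, (wc _ (M * sum_n t 0 + M * (T - sum_n t 0))); intros n.
      generalize (tail 0%nat n) (bound 0%nat n); intros h1 h2.
      replace (Series (fun i => t i * c i n)) with
        (sum_n (fun i => t i * c i n) 0 +
          (Series (fun i => t i * c i n) - sum_n (fun i => t i * c i n) 0)) by ring.
      eapply Rle_trans; [apply Rabs_triang | lra]. }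
    assert (exN : ex_series (fun n => w n * sum_n (fun i => t i * c i n) N)).
    { apply ex_series_Rabs, (wc _ (M * sum_n t N)); intros; apply bound. }
    assert (D : Rabs (L - Series (fun n => w n * sum_n (fun i => t i * c i n) N)) <=
                Series (fun n => Rabs (w n)) * M * (T - sum_n t N)).
    { unfold L; rewrite <- Series_minus by assumption.
      rewrite Rmult_assoc, <- Series_scal_r.
      assert (B : forall n, Rabs (w n * Series (fun i => t i * c i n)
          - w n * sum_n (fun i => t i * c i n) N) <= Rabs (w n) * (M * (T - sum_n t N))).
      { intros n; rewrite <- Rmult_minus_distr_l, Rabs_mult.
        apply Rmult_le_compat_l; [apply Rabs_pos | apply tail]. }
      eapply Rle_trans; [apply Series_Rabs |].
      - apply (ex_series_dominated _ (fun n => Rabs (w n)) (M * (T - sum_n t N))); [| exact Hw].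
        intros n; now rewrite Rabs_Rabsolu, (Rmult_comm (M * _)).
      - apply Series_le; [| now apply (ex_series_scal_r (M * (T - sum_n t N)))].
        intros n; split; [apply Rabs_pos | apply B]. }
    apply Rabs_le_between in D; lra.
  - replace (Finite L) with (Finite (L - 0)) by (f_equal; ring).
    exact (is_lim_seq_minus' _ _ _ _ (is_lim_seq_const L) lim).
  - replace (Finite L) with (Finite (L + 0)) by (f_equal; ring).
    exact (is_lim_seq_plus' _ _ _ _ (is_lim_seq_const L) lim).
Qed.

(** If [m <= X], the nonnegative terms [t i * (m - x i)] have a sum that is not positive, so all
    vanish; then every [t i] is [0], against their sum being [1]. *)
Lemma is_series_convex_lt (t x : nat -> R) (m X : R) :
  (forall i, 0 <= t i) -> is_series t 1 ->
  (forall i, x i < m) -> is_series (fun i => t i * x i) X -> X < m.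
Proof.
  intros t0 Ht xm HX.
  assert (S : is_series (fun i => t i * (m - x i)) (m - X)).
  { replace (m - X) with (m * 1 - X) by ring.
    apply (is_series_ext (fun i => m * t i - t i * x i)); [intros i; change (m * t i - t i * x i = t i * (m - x i)); ring |].
    exact (is_series_minus _ _ _ _ (is_series_scal_l m t 1 Ht) HX). }
  assert (pos : forall i, 0 <= t i * (m - x i)).
  { intros i; apply Rmult_le_pos; [apply t0 | specialize (xm i); lra]. }
  destruct (Rlt_or_le X m) as [lt | ge]; [exact lt | exfalso].
  assert (Z : forall i, t i = 0).
  { intros i; generalize (is_series_term_le _ _ i pos S) (t0 i) (xm i); nra. }
  assert (E : is_series (fun i => 0 * t i) (0 * 1)) by exact (is_series_scal_l 0 t 1 Ht).
  apply (is_series_ext _ t) in E; [| intros i; rewrite Z; apply Rmult_0_l].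
  apply is_series_unique in E, Ht; lra.
Qed.

(** * Derivatives of power series along lines, and the Jacobian *)

Lemma conv_disc_pred (c : nat -> R) (r : R) :
  conv_disc c -> 0 <= r < 1 -> ex_series (fun n => Rabs (c n) * r ^ pred n).
Proof.
  (* Lowering the exponent by one amounts to dividing by the radius, and [r] may be [0]; with
     [/ 2 <= s] the loss is at most a factor [2]. *)
  intros Hc hr; set (s := Rmax r (/ 2)).
  assert (s1 : r <= s) by apply Rmax_l; assert (s2 : / 2 <= s) by apply Rmax_r.
  assert (s3 : s < 1) by (apply Rmax_lub_lt; lra).
  apply (ex_series_dominated _ (fun n => Rabs (c n) * s ^ n) 2); [| apply Hc; lra].
  intros n.
  assert (p : r ^ pred n <= 2 * s ^ n).
  { apply Rle_trans with (s ^ pred n); [apply pow_incr; lra |].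
    destruct n as [| n]; simpl; [lra |].
    assert (0 <= s ^ n) by (apply pow_le; lra); nra. }
  assert (0 <= r ^ pred n) by (apply pow_le; lra).
  rewrite Rabs_mult, Rabs_Rabsolu, (Rabs_pos_eq (r ^ pred n)) by assumption.
  generalize (Rabs_pos (c n)); nra.
Qed.

Lemma ex_series_Cpow_pred (L : C -> R) (c : nat -> R) (z : C) :
  (forall w, Rabs (L w) <= Cmod w) -> conv_disc c -> in_disc z ->
  ex_series (fun n => c n * L (z ^ pred n)%C).
Proof.
  intros HL Hc hz.
  apply (ex_series_dominated _ (fun n => Rabs (c n) * Cmod z ^ pred n) 1).
  - intros n; rewrite Rabs_mult, Rmult_1_l; apply Rmult_le_compat_l; [apply Rabs_pos |].
    rewrite <- Cmod_pow; apply HL.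
  - apply conv_disc_pred; [exact Hc | split; [apply Cmod_ge_0 | exact hz]].
Qed.

Lemma Cpow_diff_bound (z w : C) (rho : R) (n : nat) :
  Cmod z <= rho -> Cmod w <= rho ->
  Cmod (w ^ n - z ^ n) <= INR n * rho ^ pred n * Cmod (w - z).
Proof.
  intros hz hw; assert (r0 := Rle_trans _ _ _ (Cmod_ge_0 z) hz).
  induction n as [| n IH].
  - simpl; replace (1 - 1)%C with (RtoC 0) by ring; rewrite Cmod_0; lra.
  - replace (w ^ S n - z ^ S n)%C with (w * (w ^ n - z ^ n) + z ^ n * (w - z))%C by (simpl; ring).
    eapply Rle_trans; [apply Cmod_triangle |].
    rewrite !Cmod_mult, Cmod_pow, S_INR; simpl pred.
    apply Rle_trans with (rho * (INR n * rho ^ pred n * Cmod (w - z)) + rho ^ n * Cmod (w - z)).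
    + apply Rplus_le_compat.
      * apply Rmult_le_compat; auto using Cmod_ge_0.
      * apply Rmult_le_compat_r; [apply Cmod_ge_0 |]; apply pow_incr; auto using Cmod_ge_0.
    + right; destruct n as [| n]; simpl; ring.
Qed.

(** The factor [rho ^ 2] on the left stands for an exponent [n - 2] on the right. Passing to [S n]
    multiplies the error by [w] and adds [n * z ^ pred n * (w - z) ^ 2], so [INR n ^ 2] suffices
    because [n ^ 2 + n <= (n + 1) ^ 2]. *)
Lemma Cpow_Taylor_bound (z w : C) (rho : R) (n : nat) :
  Cmod z <= rho -> Cmod w <= rho ->
  rho ^ 2 * Cmod (w ^ n - z ^ n - RtoC (INR n) * z ^ pred n * (w - z))
  <= INR n ^ 2 * rho ^ n * Cmod (w - z) ^ 2.
Proof.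
  intros hz hw; assert (r0 := Rle_trans _ _ _ (Cmod_ge_0 z) hz).
  induction n as [| n IH].
  - simpl; replace (1 - 1 - 0 * 1 * (w - z))%C with (RtoC 0) by ring; rewrite Cmod_0; lra.
  - replace (w ^ S n - z ^ S n - RtoC (INR (S n)) * z ^ pred (S n) * (w - z))%C
      with (w * (w ^ n - z ^ n - RtoC (INR n) * z ^ pred n * (w - z))
            + RtoC (INR n) * z ^ pred n * ((w - z) * (w - z)))%C.
    2:{ rewrite S_INR, RtoC_plus; destruct n as [| n]; simpl; ring. }
    set (E := (w ^ n - z ^ n - RtoC (INR n) * z ^ pred n * (w - z))%C) in *.
    set (q := Cmod (w - z)) in *.
    assert (n0 := pos_INR n); assert (q0 : 0 <= q) by apply Cmod_ge_0.
    assert (rn : 0 <= rho ^ n) by now apply pow_le.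
    apply Rle_trans with (rho ^ 2 * (Cmod w * Cmod E + INR n * Cmod z ^ pred n * q ^ 2)).
    { apply Rmult_le_compat_l; [nra |].
      eapply Rle_trans; [apply Cmod_triangle |].
      rewrite !Cmod_mult, Cmod_pow, Cmod_R, (Rabs_pos_eq (INR n)) by assumption.
      fold q; simpl; lra. }
    assert (a1 : rho ^ 2 * (Cmod w * Cmod E) <= rho * (INR n ^ 2 * rho ^ n * q ^ 2)).
    { apply Rle_trans with (rho * (rho ^ 2 * Cmod E)); [| now apply Rmult_le_compat_l].
      assert (0 <= rho ^ 2 * Cmod E) by (apply Rmult_le_pos; [nra | apply Cmod_ge_0]); nra. }
    assert (a2 : rho ^ 2 * (INR n * Cmod z ^ pred n * q ^ 2) <= rho * (INR n * rho ^ n * q ^ 2)).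
    { destruct n as [| n]; [simpl; lra |]; simpl pred.
      assert (Cmod z ^ n <= rho ^ n) by (apply pow_incr; auto using Cmod_ge_0).
      replace (rho * (INR (S n) * rho ^ S n * q ^ 2))
        with (rho ^ 2 * (INR (S n) * rho ^ n * q ^ 2)) by (simpl; ring).
      apply Rmult_le_compat_l; [nra |]; apply Rmult_le_compat_r; [nra |].
      now apply Rmult_le_compat_l. }
    rewrite S_INR.
    replace (rho ^ S n) with (rho * rho ^ n) by reflexivity.
    assert (0 <= rho * rho ^ n * q ^ 2) by (repeat apply Rmult_le_pos; nra).
    nra.
Qed.

(** One statement for the four partial derivatives in the Jacobian: [L] is [Re] or [Im], and the
    direction [e] is [1] or [Ci]. The factor [n ^ 2] in the Taylor remainder is absorbed by using
    [conv_disc_INR] twice. *)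
Lemma is_derive_power_series_line (L : C -> R) (c : nat -> R) (gam : R -> C) (x : R) (e : C) :
  (forall a z w, L (RtoC a * z + w)%C = a * L z + L w) ->
  (forall w, Rabs (L w) <= Cmod w) -> Cmod e = 1 ->
  (forall y, gam y = (gam x + RtoC (y - x) * e)%C) ->
  conv_disc c -> in_disc (gam x) ->
  is_derive (fun y => Series (fun n => c n * L (gam y ^ n)%C)) x
    (Series (fun n => INR n * c n * L (gam x ^ pred n * e)%C)).
Proof.
  intros Llin HL e1 Hgam Hc hz; set (z := gam x) in *.
  unfold in_disc in hz; assert (z0 := Cmod_ge_0 z).
  (* Halfway between [Cmod z] and [1]: points of the line at distance below [rho - Cmod z] stay in a
     closed disc on which the remainders are summable. *)
  set (rho := (1 + Cmod z) / 2).
  assert (near : forall y, Rabs (y - x) < rho - Cmod z -> Cmod (gam y) <= rho).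
  { intros y hy; rewrite Hgam; eapply Rle_trans; [apply Cmod_triangle |].
    rewrite Cmod_mult, e1, Cmod_R; lra. }
  apply (is_derive_Series (fun n y => c n * L (gam y ^ n)%C) _
    (fun n => / rho ^ 2 * (Rabs (INR n * (INR n * c n)) * rho ^ n)) x (rho - Cmod z)).
  - unfold rho; lra.
  - apply ex_series_Rmult_l; apply (conv_disc_INR _ (conv_disc_INR _ Hc)); unfold rho; lra.
  - apply (ex_series_Cpow_pred (fun w => L (w * e)%C) (fun n => INR n * c n)).
    + intros w; rewrite <- (Rmult_1_r (Cmod w)), <- e1, <- Cmod_mult; apply HL.
    + now apply conv_disc_INR.
    + exact hz.
  - intros y hy; apply ex_series_Cpow; try assumption.
    apply Rle_lt_trans with rho; [auto | unfold rho; lra].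
  - intros n y hy; specialize (near y hy).
    assert (T := Cpow_Taylor_bound z (gam y) rho n ltac:(unfold rho; lra) near).
    assert (E : c n * L (gam y ^ n)%C - c n * L (z ^ n)%C
                - (y - x) * (INR n * c n * L (z ^ pred n * e)%C)
              = c n * L (gam y ^ n - z ^ n - RtoC (INR n) * z ^ pred n * (gam y - z))%C).
    (* [L] is linear over the reals only, so the increment [gam y - z] is first written as a real
       multiple of [e]. *)
    { replace (gam y ^ n - z ^ n - RtoC (INR n) * z ^ pred n * (gam y - z))%C with
        (RtoC (- (INR n * (y - x))) * (z ^ pred n * e) + (RtoC (-1) * z ^ n + gam y ^ n))%C.
      - rewrite !Llin; ring.
      - rewrite (Hgam y), RtoC_opp, RtoC_mult; fold z; ring. }
    fold z; rewrite E, Rabs_mult.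
    set (D := (gam y ^ n - z ^ n - RtoC (INR n) * z ^ pred n * (gam y - z))%C) in *.
    replace (Cmod (gam y - z)) with (Rabs (y - x)) in T.
    2:{ rewrite Hgam; replace (z + RtoC (y - x) * e - z)%C with (RtoC (y - x) * e)%C by ring.
        now rewrite Cmod_mult, e1, Cmod_R, Rmult_1_r. }
    rewrite pow2_abs in T.
    assert (r1 : 0 < rho) by (unfold rho; lra); assert (r2 : 0 < rho ^ 2) by nra.
    apply Rmult_le_reg_l with (rho ^ 2); [exact r2 |].
    replace (rho ^ 2 * (/ rho ^ 2 * (Rabs (INR n * (INR n * c n)) * rho ^ n) * (y - x) ^ 2))
      with (Rabs (INR n * (INR n * c n)) * rho ^ n * (y - x) ^ 2) by (field; lra).
    rewrite !Rabs_mult, (Rabs_pos_eq (INR n)) by apply pos_INR.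
    apply Rle_trans with (Rabs (c n) * (rho ^ 2 * Cmod D)).
    + rewrite <- Rmult_assoc, (Rmult_comm (rho ^ 2)), Rmult_assoc.
      apply Rmult_le_compat_l; [apply Rabs_pos |]; apply Rmult_le_compat_l; [lra | apply HL].
    + apply Rle_trans with (Rabs (c n) * (INR n ^ 2 * rho ^ n * (y - x) ^ 2)).
      * apply Rmult_le_compat_l; [apply Rabs_pos | exact T].
      * right; ring.
Qed.

Lemma Re_linear (a : R) (z w : C) : Re (RtoC a * z + w)%C = a * Re z + Re w.
Proof. destruct z, w; unfold Re; simpl; ring. Qed.

Lemma Im_linear (a : R) (z w : C) : Im (RtoC a * z + w)%C = a * Im z + Im w.
Proof. destruct z, w; unfold Im; simpl; ring. Qed.

Lemma in_disc_line (z e : C) (x : R) (gam : R -> C) :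
  Cmod e = 1 -> (forall y, gam y = (z + RtoC (y - x) * e)%C) -> in_disc z ->
  locally x (fun y => in_disc (gam y)).
Proof.
  unfold in_disc; intros e1 Hgam hz.
  assert (d0 : 0 < 1 - Cmod z) by lra.
  exists (mkposreal _ d0); intros y hy; rewrite R_ball_iff in hy; simpl in hy.
  rewrite Hgam; eapply Rle_lt_trans; [apply Cmod_triangle |].
  rewrite Cmod_mult, e1, Cmod_R; lra.
Qed.

(** The right side is [|h'|^2 - |g'|^2]. The partial derivatives are [Re (h' + g')], [Re (h' - g')],
    [- Im (h' + g')] and [Im (h' - g')], and the determinant expands into differences of squares. *)
Lemma jacobian_harm (f : C -> C) (u v : nat -> R) (z : C) :
  conv_disc u -> conv_disc v -> in_disc z ->
  (forall w, in_disc w -> f w = harm (fun n => RtoC (u n)) (fun n => RtoC (v n)) w) ->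
  jacobian f z =
  (Series (fun n => INR n * u n * Re (z ^ pred n)%C) ^ 2
   + Series (fun n => INR n * u n * Im (z ^ pred n)%C) ^ 2)
  - (Series (fun n => INR n * v n * Re (z ^ pred n)%C) ^ 2
     + Series (fun n => INR n * v n * Im (z ^ pred n)%C) ^ 2).
Proof.
  intros Hu Hv hz Hf.
  assert (Hp : conv_disc (fun n => u n + v n)) by now apply conv_disc_plus.
  assert (Hm : conv_disc (fun n => u n - v n)) by now apply conv_disc_minus.
  assert (e2 : Cmod Ci = 1) by apply Cmod_Ci.
  assert (gx : forall y, (y, Im z) = (z + RtoC (y - Re z) * RtoC 1)%C).
  { intros y; destruct z; unfold Cplus, Cmult, Re, Im; simpl; f_equal; ring. }
  assert (gy : forall y, (Re z, y) = (z + RtoC (y - Im z) * Ci)%C).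
  { intros y; destruct z; unfold Cplus, Cmult, Re, Im; simpl; f_equal; ring. }
  assert (zz : (Re z, Im z) = z) by (destruct z; reflexivity).
  (* [f] is described on the disc only, so derivatives are transferred to the series by equality
     near the point. *)
  assert (lx := in_disc_line z 1 (Re z) (fun y => (y, Im z)) Cmod_1 gx hz).
  assert (ly := in_disc_line z Ci (Im z) (fun y => (Re z, y)) e2 gy hz).
  assert (hz' : in_disc (Re z, Im z)) by now rewrite zz.
  assert (gx' : forall y, (y, Im z) = ((Re z, Im z) + RtoC (y - Re z) * RtoC 1)%C)
    by now rewrite zz.
  assert (gy' : forall y, (Re z, y) = ((Re z, Im z) + RtoC (y - Im z) * Ci)%C) by now rewrite zz.
  assert (D1 := is_derive_power_series_line Re _ (fun y => (y, Im z)) (Re z) 1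
    Re_linear re_le_Cmod Cmod_1 gx' Hp hz').
  assert (D2 := is_derive_power_series_line Im _ (fun y => (Re z, y)) (Im z) Ci
    Im_linear im_le_Cmod e2 gy' Hm hz').
  assert (D3 := is_derive_power_series_line Re _ (fun y => (Re z, y)) (Im z) Ci
    Re_linear re_le_Cmod e2 gy' Hp hz').
  assert (D4 := is_derive_power_series_line Im _ (fun y => (y, Im z)) (Re z) 1
    Im_linear im_le_Cmod Cmod_1 gx' Hm hz').
  apply is_derive_unique in D1, D2, D3, D4; rewrite zz in D1, D2, D3, D4.
  assert (ReCi : forall w, Re (w * Ci)%C = - Im w).
  { intros w; destruct w; unfold Re, Im; simpl; ring. }
  assert (ImCi : forall w, Im (w * Ci)%C = Re w).
  { intros w; destruct w; unfold Re, Im; simpl; ring. }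
  assert (J1 : Derive (fun x => Re (f (x, Im z))) (Re z)
    = Series (fun n => INR n * (u n + v n) * Re (z ^ pred n)%C)).
  { etransitivity; [| etransitivity; [exact D1 |]].
    - refine (Derive_ext_loc _ _ _ (filter_imp _ _ _ lx)); intros y hy.
      now rewrite Hf, harm_RtoC.
    - apply Series_ext; intros; now rewrite Cmult_1_r. }
  assert (J2 : Derive (fun y => Im (f (Re z, y))) (Im z)
    = Series (fun n => INR n * (u n - v n) * Re (z ^ pred n)%C)).
  { etransitivity; [| etransitivity; [exact D2 |]].
    - refine (Derive_ext_loc _ _ _ (filter_imp _ _ _ ly)); intros y hy.
      now rewrite Hf, harm_RtoC.
    - apply Series_ext; intros; now rewrite ImCi. }
  assert (J3 : Derive (fun y => Re (f (Re z, y))) (Im z)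
    = Series (fun n => INR n * (u n + v n) * - Im (z ^ pred n)%C)).
  { etransitivity; [| etransitivity; [exact D3 |]].
    - refine (Derive_ext_loc _ _ _ (filter_imp _ _ _ ly)); intros y hy.
      now rewrite Hf, harm_RtoC.
    - apply Series_ext; intros; now rewrite ReCi. }
  assert (J4 : Derive (fun x => Im (f (x, Im z))) (Re z)
    = Series (fun n => INR n * (u n - v n) * Im (z ^ pred n)%C)).
  { etransitivity; [| etransitivity; [exact D4 |]].
    - refine (Derive_ext_loc _ _ _ (filter_imp _ _ _ lx)); intros y hy.
      now rewrite Hf, harm_RtoC.
    - apply Series_ext; intros; now rewrite Cmult_1_r. }
  assert (exu : forall L, (forall w, Rabs (L w) <= Cmod w) ->
    ex_series (fun n => INR n * u n * L (z ^ pred n)%C)).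
  { intros L HL; apply (ex_series_Cpow_pred L (fun n => INR n * u n)); auto using conv_disc_INR. }
  assert (exv : forall L, (forall w, Rabs (L w) <= Cmod w) ->
    ex_series (fun n => INR n * v n * L (z ^ pred n)%C)).
  { intros L HL; apply (ex_series_Cpow_pred L (fun n => INR n * v n)); auto using conv_disc_INR. }
  assert (add : forall L, (forall w, Rabs (L w) <= Cmod w) ->
    Series (fun n => INR n * (u n + v n) * L (z ^ pred n)%C)
    = Series (fun n => INR n * u n * L (z ^ pred n)%C)
      + Series (fun n => INR n * v n * L (z ^ pred n)%C)).
  { intros L HL; rewrite <- Series_plus by auto; apply Series_ext; intros; ring. }
  assert (sub : forall L, (forall w, Rabs (L w) <= Cmod w) ->
    Series (fun n => INR n * (u n - v n) * L (z ^ pred n)%C)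
    = Series (fun n => INR n * u n * L (z ^ pred n)%C)
      - Series (fun n => INR n * v n * L (z ^ pred n)%C)).
  { intros L HL; rewrite <- Series_minus by auto; apply Series_ext; intros; ring. }
  unfold jacobian; rewrite J1, J2, J3, J4.
  rewrite (Series_ext (fun n => INR n * (u n + v n) * - Im (z ^ pred n)%C)
    (fun n => - (INR n * (u n + v n) * Im (z ^ pred n)%C))) by (intros; ring).
  rewrite Series_opp, (add Re), (add Im), (sub Re), (sub Im)
    by (exact re_le_Cmod || exact im_le_Cmod).
  ring.
Qed.

(** * Angular derivatives *)

(** The mean value theorem, once for [phi] and once for [dphi]; this costs the factor [1 / 2] of
    Taylor's formula. *)
Lemma first_order_remainder (phi dphi ddphi : R -> R) (x y : R) :
  (forall t, is_derive phi t (dphi t)) -> (forall t, is_derive dphi t (ddphi t)) ->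
  (forall t, Rabs (ddphi t) <= 1) ->
  Rabs (phi y - phi x - (y - x) * dphi x) <= (y - x) ^ 2.
Proof.
  intros D1 D2 B.
  destruct (MVT_gen phi x y dphi) as [s [hs E]].
  - intros; apply D1.
  - intros t _; apply continuity_pt_filterlim, (ex_derive_continuous phi); eexists; apply D1.
  - destruct (MVT_gen dphi x s ddphi) as [s' [_ E']].
    + intros; apply D2.
    + intros t _; apply continuity_pt_filterlim, (ex_derive_continuous dphi); eexists; apply D2.
    + replace (phi y - phi x - (y - x) * dphi x) with ((dphi s - dphi x) * (y - x)) by (rewrite E; ring).
      rewrite E', !Rabs_mult, <- (pow2_abs (y - x)).
      assert (Rabs (s - x) <= Rabs (y - x)).
      { revert hs; unfold Rmin, Rmax; destruct (Rle_dec x y); intros hs.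
        - rewrite !Rabs_pos_eq; lra.
        - rewrite !Rabs_left1; lra. }
      generalize (B s') (Rabs_pos (ddphi s')) (Rabs_pos (s - x)) (Rabs_pos (y - x)); intros.
      assert (Rabs (ddphi s') * Rabs (s - x) <= Rabs (y - x)) by nra.
      nra.
Qed.

(* The pair [(phi, dphi)] stands for [(cos, - sin)], [(sin, cos)] or [(- sin, - cos)]. *)
Lemma is_derive_trig_series (phi dphi : R -> R) (c : nat -> R) (r x : R) :
  (forall t, is_derive phi t (dphi t)) -> (forall t, is_derive dphi t (- phi t)) ->
  (forall t, Rabs (phi t) <= 1) -> (forall t, Rabs (dphi t) <= 1) ->
  conv_disc c -> 0 <= r < 1 ->
  is_derive (fun t => Series (fun n => c n * r ^ n * phi (INR n * t))) x
    (Series (fun n => INR n * c n * r ^ n * dphi (INR n * x))).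
Proof.
  intros D1 D2 B1 B2 Hc hr.
  assert (Ex : forall a psi, (forall t : R, Rabs (psi t) <= 1) -> conv_disc a ->
     forall t, ex_series (fun n => a n * r ^ n * psi (INR n * t))).
  { intros a psi Hpsi Ha t.
    apply (ex_series_dominated _ (fun n => Rabs (a n) * r ^ n) 1); [| now apply Ha].
    intros n; assert (0 <= r ^ n) by (apply pow_le; lra).
    rewrite !Rabs_mult, (Rabs_pos_eq (r ^ n)), Rmult_1_l by assumption.
    rewrite <- (Rmult_1_r (Rabs (a n) * r ^ n)) at 2.
    apply Rmult_le_compat_l; [apply Rmult_le_pos; [apply Rabs_pos | assumption] | apply Hpsi]. }
  apply (is_derive_Series (fun n t => c n * r ^ n * phi (INR n * t)) _
    (fun n => Rabs (INR n * (INR n * c n)) * r ^ n) x 1).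
  - lra.
  - now apply (conv_disc_INR _ (conv_disc_INR _ Hc)).
  - apply (Ex (fun n => INR n * c n)); [exact B2 | now apply conv_disc_INR].
  - intros y _; now apply Ex.
  - intros n y _.
    assert (T := first_order_remainder phi dphi (fun t => - phi t) (INR n * x) (INR n * y) D1 D2
      (fun t => eq_ind_r (fun s => s <= 1) (B1 t) (Rabs_Ropp (phi t)))).
    replace (c n * r ^ n * phi (INR n * y) - c n * r ^ n * phi (INR n * x)
        - (y - x) * (INR n * c n * r ^ n * dphi (INR n * x)))
      with (c n * r ^ n * (phi (INR n * y) - phi (INR n * x)
        - (INR n * y - INR n * x) * dphi (INR n * x))) by ring.
    assert (0 <= r ^ n) by (apply pow_le; lra).
    rewrite !Rabs_mult, (Rabs_pos_eq (r ^ n)), (Rabs_pos_eq (INR n))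
      by (assumption || apply pos_INR).
    apply Rle_trans with (Rabs (c n) * r ^ n * (INR n * y - INR n * x) ^ 2).
    + apply Rmult_le_compat_l; [apply Rmult_le_pos; [apply Rabs_pos | assumption] | exact T].
    + right; ring.
Qed.

(** On a circle, differentiation in the angle stays within trigonometric series. The function [psi]
    is chosen before the coefficients [c], which makes the derivative a fixed linear functional of
    them. *)
Lemma Derive_n_trig_series (phi dphi : R -> R) (r x : R) (m : nat) :
  (forall t, is_derive phi t (dphi t)) -> (forall t, is_derive dphi t (- phi t)) ->
  (forall t, Rabs (phi t) <= 1) -> (forall t, Rabs (dphi t) <= 1) ->
  0 <= r < 1 -> (m <= 2)%nat ->
  exists psi, (forall t, Rabs (psi t) <= 1) /\ forall c, conv_disc c ->
    Derive_n (fun t => Series (fun n => c n * r ^ n * phi (INR n * t))) m x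
    = Series (fun n => INR n ^ m * c n * r ^ n * psi (INR n * x)).
Proof.
  intros D1 D2 B1 B2 hr hm.
  assert (B3 : forall t, Rabs (- phi t) <= 1) by (intros; rewrite Rabs_Ropp; apply B1).
  assert (D3 : forall t, is_derive (fun t => - phi t) t (- dphi t)).
  { intros t; apply (is_derive_opp phi), D1. }
  destruct m as [| [| [| m]]]; [| | | lia].
  - exists phi; split; [exact B1 |]; intros c Hc; simpl; apply Series_ext; intros; ring.
  - exists dphi; split; [exact B2 |]; intros c Hc; simpl.
    etransitivity; [apply is_derive_unique, (is_derive_trig_series phi dphi); assumption |].
    apply Series_ext; intros; ring.
  - exists (fun t => - phi t); split; [exact B3 |]; intros c Hc; simpl.
    etransitivity; [apply Derive_ext; intros t;
      apply is_derive_unique, (is_derive_trig_series phi dphi); assumption |].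
    etransitivity; [apply is_derive_unique,
      (is_derive_trig_series dphi (fun t => - phi t) (fun n => INR n * c n)); try assumption |].
    + now apply conv_disc_INR.
    + apply Series_ext; intros; ring.
Qed.

Lemma polar_pow (r t : R) (n : nat) :
  (polar r t ^ n)%C = (r ^ n * cos (INR n * t), r ^ n * sin (INR n * t)).
Proof.
  induction n as [| n IH].
  - simpl; rewrite Rmult_0_l, cos_0, sin_0; unfold RtoC; f_equal; ring.
  - rewrite Cpow_S, IH, S_INR, Rmult_plus_distr_r, Rmult_1_l, cos_plus, sin_plus.
    unfold Cmult, polar; simpl; f_equal; ring.
Qed.

Lemma in_disc_polar (r t : R) : 0 <= r < 1 -> in_disc (polar r t).
Proof.
  intros hr; unfold in_disc, Cmod, polar; simpl.
  replace (r * cos t * (r * cos t * 1) + r * sin t * (r * sin t * 1)) with (r ^ 2).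
  - rewrite sqrt_pow2; lra.
  - generalize (sin2_cos2 t); unfold Rsqr; intros E.
    replace (r ^ 2) with (r ^ 2 * (sin t * sin t + cos t * cos t)) by (rewrite E; ring); ring.
Qed.

Lemma Omega_RtoC_polar (nu : R) (u v : nat -> R) (r t : R) :
  conv_disc (fun n => omega_mult nu n * u n) -> conv_disc (fun n => omega_mult nu n * v n) ->
  0 <= r < 1 ->
  Omega nu (fun n => RtoC (u n)) (fun n => RtoC (v n)) (polar r t)
  = (Series (fun n => omega_mult nu n * (u n + v n) * r ^ n * cos (INR n * t)),
     Series (fun n => omega_mult nu n * (u n - v n) * r ^ n * sin (INR n * t))).
Proof.
  intros Hu Hv hr; unfold Omega.
  assert (E : forall w, omega_coefs nu (fun n => RtoC (w n)) = fun n => RtoC (omega_mult nu n * w n)).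
  { intros w; apply functional_extensionality; intros n; unfold omega_coefs.
    now rewrite RtoC_mult. }
  rewrite !E, harm_RtoC by (assumption || now apply in_disc_polar).
  f_equal; apply Series_ext; intros n; rewrite polar_pow; unfold Re, Im; simpl; ring.
Qed.

Lemma conv_disc_omega (nu : R) (c : nat -> R) :
  0 <= nu < 1 -> conv_disc c -> conv_disc (fun n => omega_mult nu n * c n).
Proof.
  intros hnu Hc; destruct (omega_mult_bound nu hnu) as [C [C0 HC]].
  apply (conv_disc_dominated _ (fun n => INR n * Rabs (c n) + Rabs (c n)) C).
  - intros n; rewrite Rabs_mult; generalize (pos_INR n) (Rabs_pos (c n)) (HC n); intros.
    rewrite (Rabs_pos_eq (_ + _)) by nra.
    replace (C * (INR n * Rabs (c n) + Rabs (c n))) with (C * (INR n + 1) * Rabs (c n)) by ring.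
    now apply Rmult_le_compat_r.
  - assert (Ha : conv_disc (fun n => Rabs (c n))).
    { apply (conv_disc_dominated _ c 1); [intros n; rewrite Rabs_Rabsolu; lra | exact Hc]. }
    apply conv_disc_plus; [now apply (conv_disc_INR (fun n => Rabs (c n))) | exact Ha].
Qed.

Lemma is_derive_neg_sin (t : R) : is_derive (fun t => - sin t) t (- cos t).
Proof. auto_derive; [auto | ring]. Qed.

(** The order of the quantifiers is the point: [w] and [w'] serve all [u] and [v], as the
    interchange of sums requires. *)
Lemma dtheta_Omega_weights (nu r theta : R) (m : nat) :
  0 <= nu < 1 -> 0 <= r < 1 -> (m <= 2)%nat ->
  exists w w' : nat -> R,
    ex_series (fun n => Rabs (w n)) /\ ex_series (fun n => Rabs (w' n)) /\
    forall u v, conv_disc u -> conv_disc v ->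
      dtheta m (Omega nu (fun n => RtoC (u n)) (fun n => RtoC (v n))) r theta
      = (Series (fun n => w n * (u n + v n)), Series (fun n => w' n * (u n - v n))).
Proof.
  intros hnu hr hm.
  assert (Bs : forall t, Rabs (- sin t) <= 1).
  { intros; rewrite Rabs_Ropp; apply Rabs_le, SIN_bound. }
  assert (Bc : forall t, Rabs (cos t) <= 1) by (intros; apply Rabs_le, COS_bound).
  assert (Bs' : forall t, Rabs (sin t) <= 1) by (intros; apply Rabs_le, SIN_bound).
  destruct (Derive_n_trig_series cos (fun t => - sin t) r theta m is_derive_cos
    is_derive_neg_sin Bc Bs hr hm) as [psi [Hpsi Dcos]].
  destruct (Derive_n_trig_series sin cos r theta m is_derive_sin is_derive_cos Bs' Bc hr hm)
    as [psi' [Hpsi' Dsin]].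
  (* Up to a trigonometric factor bounded by [1], the weights are the terms at radius [r] of the
     series obtained from the constant coefficients [1]. *)
  assert (Hone : conv_disc (fun n => INR n ^ m * (omega_mult nu n * 1))).
  { assert (H1 := conv_disc_omega nu (fun _ => 1) hnu
      (conv_disc_bounded (fun _ => 1) 1 (fun n => Req_le _ _ Rabs_R1))).
    clear - H1; induction m as [| m IH].
    - apply (conv_disc_dominated _ (fun n => omega_mult nu n * 1) 1); [| exact H1].
      intros n; simpl; rewrite !Rmult_1_l; lra.
    - apply conv_disc_INR in IH; revert IH; apply (conv_disc_dominated _ _ 1).
      intros n; right; rewrite Rmult_1_l; f_equal; simpl; ring. }
  assert (sum : forall chi, (forall t : R, Rabs (chi t) <= 1) ->
    ex_series (fun n => Rabs (INR n ^ m * omega_mult nu n * r ^ n * chi (INR n * theta)))).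
  { intros chi Hchi; apply (ex_series_dominated _
      (fun n => Rabs (INR n ^ m * (omega_mult nu n * 1)) * r ^ n) 1); [| now apply Hone].
    intros n; assert (0 <= r ^ n) by (apply pow_le; lra).
    rewrite Rabs_Rabsolu, Rabs_mult, (Rabs_mult _ (r ^ n)), (Rabs_pos_eq (r ^ n)) by assumption.
    rewrite Rmult_1_r, Rmult_1_l.
    match goal with |- ?p * _ <= _ => rewrite <- (Rmult_1_r p) at 2 end.
    apply Rmult_le_compat_l; [apply Rmult_le_pos; [apply Rabs_pos | assumption] | apply Hchi]. }
  exists (fun n => INR n ^ m * omega_mult nu n * r ^ n * psi (INR n * theta)),
    (fun n => INR n ^ m * omega_mult nu n * r ^ n * psi' (INR n * theta)).
  split; [now apply sum | split; [now apply sum |]].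
  intros u v Hu Hv; unfold dtheta.
  assert (E : forall t, Omega nu (fun n => RtoC (u n)) (fun n => RtoC (v n)) (polar r t) = _)
    by (intros t; apply Omega_RtoC_polar; auto using conv_disc_omega).
  f_equal.
  - rewrite (Derive_n_ext _ (fun t => Series (fun n =>
      omega_mult nu n * (u n + v n) * r ^ n * cos (INR n * t)))) by (intros t; now rewrite E).
    rewrite Dcos by (apply conv_disc_omega; [exact hnu | now apply conv_disc_plus]).
    apply Series_ext; intros; ring.
  - rewrite (Derive_n_ext _ (fun t => Series (fun n =>
      omega_mult nu n * (u n - v n) * r ^ n * sin (INR n * t)))) by (intros t; now rewrite E).
    rewrite Dsin by (apply conv_disc_omega; [exact hnu | now apply conv_disc_minus]).
    apply Series_ext; intros; ring.
Qed.

(** * The linear form of univalence *)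

(** The coefficients of the identity function: [u n - kron n] are those of [h(z) - z]. *)
Definition kron (n : nat) : R := if Nat.eqb n 1 then 1 else 0.

Lemma is_series_kron (x : nat -> R) : is_series (fun n => kron n * x n) (x 1%nat).
Proof.
  change (is_lim_seq (sum_n (fun n => kron n * x n)) (x 1%nat)).
  apply (is_lim_seq_ext_loc (fun _ => x 1%nat)); [| apply is_lim_seq_const].
  exists 1%nat; intros n hn; induction hn as [| n hn IH].
  - rewrite sum_Sn, sum_O; unfold plus, kron; simpl; ring.
  - rewrite sum_Sn, <- IH; unfold plus, kron; simpl.
    destruct n as [| n]; [lia | simpl; ring].
Qed.

Definition sign_pattern (u v : nat -> R) : Prop :=
  u 0%nat = 0 /\ u 1%nat = 1 /\ v 0%nat = 0 /\
  (forall n, (2 <= n)%nat -> u n <= 0) /\ (forall n, (1 <= n)%nat -> 0 <= v n).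

(* [h' (r) - g' (r)] for [h], [g] with coefficients [u], [v]. *)
Definition gap (u v : nat -> R) (r : R) : R :=
  Series (fun n => INR n * (u n - v n) * r ^ pred n).

Lemma sign_pattern_abs (u v : nat -> R) (n : nat) :
  sign_pattern u v ->
  Rabs (u n - kron n) = kron n - u n /\ Rabs (v n) = v n.
Proof.
  intros (u0 & u1 & v0 & un & vn); unfold kron.
  destruct n as [| [| n]]; simpl.
  - rewrite u0, v0, Rminus_0_r, Rabs_R0; auto.
  - rewrite u1, Rminus_diag, Rabs_R0; split; [reflexivity |]; apply Rabs_pos_eq, vn; lia.
  - assert (h := un (S (S n)) ltac:(lia)); rewrite Rabs_left1 by lra.
    split; [ring |]; apply Rabs_pos_eq, vn; lia.
Qed.

Lemma is_series_gap (u v : nat -> R) (r : R) :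
  conv_disc u -> conv_disc v -> 0 <= r < 1 ->
  is_series (fun n => INR n * (u n - v n) * r ^ pred n) (gap u v r).
Proof.
  intros Hu Hv hr; apply Series_correct, ex_series_Rabs.
  apply (ex_series_ext (fun n => Rabs (INR n * (u n - v n)) * r ^ pred n)).
  - intros n; now rewrite (Rabs_mult _ (r ^ pred n)), (Rabs_pos_eq (r ^ pred n)) by (apply pow_le; lra).
  - apply conv_disc_pred; [| exact hr].
    now apply (conv_disc_INR (fun n => u n - v n)), conv_disc_minus.
Qed.

(** Here the sign pattern does its work: it makes the moduli linear in the coefficients, so the sum
    that controls the distance of [f] from the identity is exactly [1 - gap u v r]. *)
Lemma is_series_one_minus_gap (u v : nat -> R) (r : R) :
  sign_pattern u v -> conv_disc u -> conv_disc v -> 0 <= r < 1 ->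
  is_series (fun n => INR n * (Rabs (u n - kron n) + Rabs (v n)) * r ^ pred n) (1 - gap u v r).
Proof.
  intros P Hu Hv hr.
  assert (K := is_series_kron (fun n => INR n * r ^ pred n)); simpl in K.
  rewrite Rmult_1_l in K.
  generalize (is_series_minus _ _ _ _ K (is_series_gap u v r Hu Hv hr)).
  apply is_series_ext; intros n; destruct (sign_pattern_abs u v n P) as [-> ->].
  change (kron n * (INR n * r ^ pred n) - INR n * (u n - v n) * r ^ pred n
          = INR n * (kron n - u n + v n) * r ^ pred n); ring.
Qed.

(** A single term of the nonnegative series for [1 - gap u v r] is below [1]; the factor [INR n] is
    dropped and [r] sent to [1]. The index [1] is read separately, since there [u] equals [1]. *)
Lemma gap_pos_bounded (u v : nat -> R) (n : nat) :
  sign_pattern u v -> conv_disc u -> conv_disc v ->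
  (forall r, 0 <= r < 1 -> 0 < gap u v r) ->
  Rabs (u n) <= 1 /\ Rabs (v n) <= 1.
Proof.
  intros P Hu Hv Hgap.
  destruct (sign_pattern_abs u v n P) as [Eu Ev].
  assert (le1 : (1 <= n)%nat -> Rabs (u n - kron n) + Rabs (v n) <= 1).
  { intros hn; set (e := Rabs (u n - kron n) + Rabs (v n)).
    assert (e0 : 0 <= e) by (unfold e; generalize (Rabs_pos (u n - kron n)) (Rabs_pos (v n)); lra).
    assert (n1 : 1 <= INR n) by (change 1 with (INR 1); now apply le_INR).
    assert (B : forall r, 0 <= r < 1 -> e * r ^ pred n <= 1).
    { intros r hr; assert (r0 : forall k, 0 <= r ^ k) by (intros; apply pow_le; lra).
      assert (T := is_series_term_le _ _ n
        (fun k => Rmult_le_pos _ _ (Rmult_le_pos _ _ (pos_INR k)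
          (Rplus_le_le_0_compat _ _ (Rabs_pos (u k - kron k)) (Rabs_pos (v k)))) (r0 (pred k)))
        (is_series_one_minus_gap u v r P Hu Hv hr)).
      cbv beta in T; fold e in T; specialize (Hgap r hr); specialize (r0 (pred n)).
      assert (0 <= e * r ^ pred n) by now apply Rmult_le_pos.
      rewrite Rmult_assoc in T; nra. }
    apply (is_lim_seq_le (fun m => e * (1 - / (INR m + 1)) ^ pred n) (fun _ => 1) e 1).
    - intros m; apply B.
      assert (h := pos_INR m).
      assert (0 < / (INR m + 1)) by (apply Rinv_0_lt_compat; lra).
      assert (/ (INR m + 1) <= 1) by (rewrite <- Rinv_1; apply Rinv_le_contravar; lra).
      lra.
    - assert (L : is_lim_seq (fun m => 1 - / (INR m + 1)) 1).
      { replace (Finite 1) with (Finite (1 - 0)) by (f_equal; ring).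
        apply is_lim_seq_minus'; [apply is_lim_seq_const |].
        apply (is_lim_seq_ext (fun m => / INR (S m))); [intros; now rewrite S_INR |].
        apply (is_lim_seq_incr_1 (fun m => / INR m)).
        change (Finite 0) with (Rbar_inv p_infty).
        apply is_lim_seq_inv; [apply is_lim_seq_INR | discriminate]. }
      generalize (pred n); intros k.
      replace (Finite e) with (Finite (e * 1 ^ k)) by (rewrite pow1; f_equal; ring).
      apply (is_lim_seq_scal_l _ e (1 ^ k)).
      induction k as [| k IH]; [apply is_lim_seq_const |].
      exact (is_lim_seq_mult' _ _ _ _ L IH).
    - apply is_lim_seq_const. }
  destruct n as [| [| n]].
  - destruct P as (-> & _ & -> & _); rewrite Rabs_R0; lra.
  - destruct P as (_ & u1 & _); specialize (le1 ltac:(lia)); rewrite u1, Rabs_R1.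
    generalize (Rabs_pos (u 1%nat - kron 1)); lra.
  - specialize (le1 ltac:(lia)).
    replace (kron (S (S n))) with 0 in le1 by reflexivity; rewrite Rminus_0_r in le1.
    generalize (Rabs_pos (u (S (S n)))) (Rabs_pos (v (S (S n)))); lra.
Qed.

(* On the real axis the Jacobian factors as [(h' + g') (h' - g')], so the second factor, which
   is positive at [0], cannot change sign. *)
Lemma gap_pos_of_sense_preserving (f : C -> C) (u v : nat -> R) (r : R) :
  conv_disc u -> conv_disc v -> u 1%nat = 1 -> v 1%nat < 1 ->
  (forall w, in_disc w -> f w = harm (fun n => RtoC (u n)) (fun n => RtoC (v n)) w) ->
  sense_preserving f -> 0 <= r < 1 -> 0 < gap u v r.
Proof.
  intros Hu Hv u1 v1 Hf Hs hr.
  assert (gap_nz : forall s, 0 <= s < 1 -> gap u v s <> 0).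
  { intros s hs E.
    assert (hz : in_disc (RtoC s)) by (unfold in_disc; rewrite Cmod_R, Rabs_pos_eq; lra).
    assert (J := Hs _ hz); rewrite (jacobian_harm f u v _ Hu Hv hz Hf) in J.
    assert (ReE : forall n, Re (RtoC s ^ n)%C = s ^ n) by (intros; now rewrite <- RtoC_pow).
    assert (ImE : forall n, Im (RtoC s ^ n)%C = 0) by (intros; now rewrite <- RtoC_pow).
    assert (Z : forall c : nat -> R, Series (fun n => INR n * c n * Im (RtoC s ^ pred n)%C) = 0).
    { intros c; rewrite (Series_ext _ (fun n => 0 * (INR n * c n))) by (intros; rewrite ImE; ring).
      rewrite Series_scal_l; ring. }
    rewrite !Z in J.
    assert (D : gap u v s = Series (fun n => INR n * u n * Re (RtoC s ^ pred n)%C)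
                            - Series (fun n => INR n * v n * Re (RtoC s ^ pred n)%C)).
    { unfold gap; rewrite <- Series_minus.
      - apply Series_ext; intros n; rewrite ReE; ring.
      - apply (ex_series_Cpow_pred Re (fun n => INR n * u n)); auto using conv_disc_INR, re_le_Cmod.
      - apply (ex_series_Cpow_pred Re (fun n => INR n * v n)); auto using conv_disc_INR, re_le_Cmod. }
    rewrite E in D; nra. }
  (* The term of index [0] carries [INR 0] and drops out by a shift; continuity then follows from
     the radius of convergence. *)
  assert (PS : forall s, gap u v s = PSeries (PS_derive (fun n => u n - v n)) s).
  { intros s; unfold gap; rewrite Series_incr_1_aux by (simpl; ring); reflexivity. }
  assert (gap0 : 0 < gap u v 0).
  { rewrite PS, PSeries_0; unfold PS_derive; rewrite u1; simpl; lra. }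
  destruct (Rlt_or_le 0 (gap u v r)) as [pos | neg]; [exact pos | exfalso].
  assert (r0 : 0 < r).
  { destruct (Rle_lt_or_eq_dec 0 r (proj1 hr)) as [lt | <-]; [exact lt | lra]. }
  (* The sign is reversed because [IVT_interv] expects a function that goes from negative to
     positive. *)
  destruct (IVT_interv (fun s => - gap u v s) 0 r) as [s [hs E]].
  - intros s hs; apply (continuity_pt_opp (gap u v)).
    apply (continuity_pt_ext (PSeries (PS_derive (fun n => u n - v n)))); [intros; now rewrite PS |].
    apply PSeries_continuity; rewrite CV_radius_derive, Rabs_pos_eq by lra.
    apply conv_disc_CV_radius; [now apply conv_disc_minus | lra].
  - exact r0.
  - lra.
  - destruct (Rle_lt_or_eq_dec _ _ neg) as [lt | eq]; [lra | now destruct (gap_nz r hr)].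
  - apply (gap_nz s); lra.
Qed.

(** If the values agree, [z - w] is the increment of the identity minus [f]. Its terms are bounded
    through [Cpow_diff_bound] at the larger modulus [rho], so [Cmod (z - w) <= (1 - gap u v rho) *
    Cmod (z - w)], which forces [z = w]. *)
Lemma gap_pos_univalent (u v : nat -> R) (z w : C) :
  sign_pattern u v -> conv_disc u -> conv_disc v ->
  (forall r, 0 <= r < 1 -> 0 < gap u v r) -> in_disc z -> in_disc w ->
  harm (fun n => RtoC (u n)) (fun n => RtoC (v n)) z
  = harm (fun n => RtoC (u n)) (fun n => RtoC (v n)) w -> z = w.
Proof.
  intros P Hu Hv Hgap hz hw E.
  rewrite !harm_RtoC in E by assumption; injection E as ERe EIm.
  set (rho := Rmax (Cmod z) (Cmod w)).
  assert (zr : Cmod z <= rho) by apply Rmax_l; assert (wr : Cmod w <= rho) by apply Rmax_r.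
  assert (hr : 0 <= rho < 1).
  { split; [eapply Rle_trans; [apply Cmod_ge_0 | exact zr] | now apply Rmax_lub_lt]. }
  assert (part : forall (L : C -> R) (c : nat -> R), (forall x, Rabs (L x) <= Cmod x) ->
    (forall x y, L (x - y)%C = L x - L y) -> conv_disc c ->
    Series (fun n => c n * L (z ^ n)%C) = Series (fun n => c n * L (w ^ n)%C) ->
    is_series (fun n => (kron n - c n) * L (z ^ n - w ^ n)%C) (L (z - w)%C)).
  { intros L c HL Lsub Hc Ec.
    assert (Sz := Series_correct _ (ex_series_Cpow L c z HL Hc hz)).
    assert (Sw := Series_correct _ (ex_series_Cpow L c w HL Hc hw)).
    assert (K := is_series_kron (fun n => L (z ^ n - w ^ n)%C)); cbv beta in K.
    rewrite !Cpow_1_r in K.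
    generalize (is_series_minus _ _ _ _ K (is_series_minus _ _ _ _ Sz Sw)).
    change (@plus R_AbelianGroup) with Rplus; change (@opp R_AbelianGroup) with Ropp.
    rewrite Ec; intros S.
    replace (L (z - w)%C) with (L (z - w)%C + - (Series (fun n => c n * L (w ^ n)%C)
      + - Series (fun n => c n * L (w ^ n)%C))) by ring.
    revert S; apply is_series_ext; intros n; rewrite Lsub.
    change (kron n * (L (z ^ n)%C - L (w ^ n)%C) - (c n * L (z ^ n)%C - c n * L (w ^ n)%C)
            = (kron n - c n) * (L (z ^ n)%C - L (w ^ n)%C)); ring. }
  assert (SRe := part Re _ re_le_Cmod (fun x y => eq_refl) (conv_disc_plus _ _ Hu Hv) ERe).
  assert (SIm := part Im _ im_le_Cmod (fun x y => eq_refl) (conv_disc_minus _ _ Hu Hv) EIm).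
  assert (le : Cmod (z - w) <= (1 - gap u v rho) * Cmod (z - w)).
  { replace (Cmod (z - w)) with (Cmod (Re (z - w)%C, Im (z - w)%C)) at 1.
    - refine (Cmod_is_series_le _ _ _ _ _ _ _ SRe SIm
        (is_series_scal_r (Cmod (z - w)) _ _ (is_series_one_minus_gap u v rho P Hu Hv hr))).
      intros n; cbv beta.
      replace ((kron n - (u n + v n)) * Re (z ^ n - w ^ n)%C,
               (kron n - (u n - v n)) * Im (z ^ n - w ^ n)%C)
        with (RtoC (kron n - u n) * (z ^ n - w ^ n) + RtoC (- v n) * Cconj (z ^ n - w ^ n))%C.
      2:{ destruct (z ^ n - w ^ n)%C; unfold Cplus, Cmult, Cconj, Re, Im; simpl; f_equal; ring. }
      eapply Rle_trans; [apply Cmod_triangle |].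
      rewrite !Cmod_mult, Cmod_conj, !Cmod_R, Rabs_Ropp, (Rabs_minus_sym (kron n)).
      assert (D := Cpow_diff_bound w z rho n wr zr).
      generalize (Rabs_pos (u n - kron n)) (Rabs_pos (v n)); intros.
      rewrite <- Rmult_plus_distr_r.
      apply Rle_trans with
        ((Rabs (u n - kron n) + Rabs (v n)) * (INR n * rho ^ pred n * Cmod (z - w))).
      + apply Rmult_le_compat_l; [lra | exact D].
      + right; ring.
    - f_equal; destruct (z - w)%C; reflexivity. }
  assert (Z : Cmod (z - w) = 0).
  { specialize (Hgap rho hr); generalize (Cmod_ge_0 (z - w)); intros; nra. }
  apply Cmod_eq_0 in Z.
  replace z with ((z - w) + w)%C by ring; rewrite Z; ring.
Qed.

(** With [A] bounding [|h' - 1|], [B] bounding [|g'|], and [A + B < 1], the real part of [h'] alone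
    is at least [1 - A > B]. *)
Lemma gap_pos_sense_preserving (u v : nat -> R) :
  sign_pattern u v -> conv_disc u -> conv_disc v ->
  (forall r, 0 <= r < 1 -> 0 < gap u v r) ->
  sense_preserving (harm (fun n => RtoC (u n)) (fun n => RtoC (v n))).
Proof.
  intros P Hu Hv Hgap z hz.
  rewrite (jacobian_harm _ u v z Hu Hv hz) by reflexivity.
  assert (hr : 0 <= Cmod z < 1) by (split; [apply Cmod_ge_0 | exact hz]).
  assert (Ha : conv_disc (fun n => u n - kron n)).
  { apply conv_disc_minus; [exact Hu |]; apply (conv_disc_bounded _ 1).
    intros n; unfold kron; destruct (Nat.eqb n 1); [rewrite Rabs_R1 | rewrite Rabs_R0]; lra. }
  assert (abs : forall c, conv_disc c -> ex_series (fun n => INR n * Rabs (c n) * Cmod z ^ pred n)).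
  { intros c Hc; apply (ex_series_ext (fun n => Rabs (INR n * c n) * Cmod z ^ pred n)).
    - intros n; now rewrite Rabs_mult, (Rabs_pos_eq (INR n)) by apply pos_INR.
    - apply conv_disc_pred; [now apply conv_disc_INR | exact hr]. }
  set (A := Series (fun n => INR n * Rabs (u n - kron n) * Cmod z ^ pred n)).
  set (B := Series (fun n => INR n * Rabs (v n) * Cmod z ^ pred n)).
  assert (AB : A + B = 1 - gap u v (Cmod z)).
  { rewrite <- (is_series_unique _ _ (is_series_one_minus_gap u v _ P Hu Hv hr)).
    unfold A, B; rewrite <- Series_plus by auto; apply Series_ext; intros; ring. }
  assert (small : forall c, conv_disc c ->
    Cmod (Series (fun n => INR n * c n * Re (z ^ pred n)%C),
          Series (fun n => INR n * c n * Im (z ^ pred n)%C))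
    <= Series (fun n => INR n * Rabs (c n) * Cmod z ^ pred n)).
  { intros c Hc.
    eapply Cmod_is_series_le.
    2:{ apply Series_correct, (ex_series_Cpow_pred Re (fun n => INR n * c n));
        auto using conv_disc_INR, re_le_Cmod. }
    2:{ apply Series_correct, (ex_series_Cpow_pred Im (fun n => INR n * c n));
        auto using conv_disc_INR, im_le_Cmod. }
    2:{ apply Series_correct; auto. }
    intros n; right.
    replace (INR n * c n * Re (z ^ pred n)%C, INR n * c n * Im (z ^ pred n)%C)
      with (RtoC (INR n * c n) * z ^ pred n)%C.
    - rewrite Cmod_mult, Cmod_pow, Cmod_R, Rabs_mult, (Rabs_pos_eq (INR n)) by apply pos_INR.
      reflexivity.
    - destruct (z ^ pred n)%C; unfold Cmult, Re, Im; simpl; f_equal; ring. }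
  assert (hA := small _ Ha); assert (hB := small _ Hv); fold A in hA; fold B in hB.
  set (p := Series (fun n => INR n * v n * Re (z ^ pred n)%C)) in *.
  set (q := Series (fun n => INR n * v n * Im (z ^ pred n)%C)) in *.
  assert (hB' : p ^ 2 + q ^ 2 <= B ^ 2).
  { change (p ^ 2 + q ^ 2) with (Re (p, q) ^ 2 + Im (p, q) ^ 2); rewrite <- Cmod2_alt.
    apply pow_incr; split; [apply Cmod_ge_0 | exact hB]. }
  assert (hP : 1 - A <= Series (fun n => INR n * u n * Re (z ^ pred n)%C)).
  { assert (X : Series (fun n => INR n * (u n - kron n) * Re (z ^ pred n)%C)
              = Series (fun n => INR n * u n * Re (z ^ pred n)%C) - 1).
    { assert (K := is_series_kron (fun n => INR n * Re (z ^ pred n)%C)); simpl in K.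
      rewrite Rmult_1_l in K; change (Re (RtoC 1)) with 1 in K.
      apply is_series_unique.
      assert (S := Series_correct _ (ex_series_Cpow_pred Re (fun n => INR n * u n) z
        re_le_Cmod (conv_disc_INR _ Hu) hz)).
      generalize (is_series_minus _ _ _ _ S K); apply is_series_ext; intros n.
      change (INR n * u n * Re (z ^ pred n)%C - kron n * (INR n * Re (z ^ pred n)%C)
              = INR n * (u n - kron n) * Re (z ^ pred n)%C); ring. }
    assert (Y : Rabs (Series (fun n => INR n * (u n - kron n) * Re (z ^ pred n)%C)) <= A)
      by exact (Rle_trans _ _ _ (re_le_Cmod (_, _)) hA).
    rewrite X in Y; apply Rabs_le_between in Y; lra. }
  assert (B0 : 0 <= B) by (eapply Rle_trans; [apply Cmod_ge_0 | exact hB]).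
  specialize (Hgap _ hr).
  generalize (pow2_ge_0 (Series (fun n => INR n * u n * Im (z ^ pred n)%C))); intros.
  nra.
Qed.

(** * Passing between the class and its coefficients *)

Lemma HMbar_coefs (beta lambda k nu : R) (f : C -> C) :
  HMbar beta lambda k nu f ->
  exists uv : (nat -> R) * (nat -> R),
    sign_pattern (fst uv) (snd uv) /\ conv_disc (fst uv) /\ conv_disc (snd uv) /\
    (forall r, 0 <= r < 1 -> 0 < gap (fst uv) (snd uv) r) /\
    (forall z, in_disc z ->
       f z = harm (fun n => RtoC (fst uv n)) (fun n => RtoC (snd uv n)) z) /\
    (forall r theta, 0 < r < 1 -> beta < Re (HM_expr lambda k
       (Omega nu (fun n => RtoC (fst uv n)) (fun n => RtoC (snd uv n))) r theta)).
Proof.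
  intros (a & b & (((a0 & a1 & Ha) & (b0 & b1 & Hb) & Hf & _ & Hs) & HRe) & an & bn).
  assert (Ea : a = fun n => RtoC (Re (a n))).
  { apply functional_extensionality; intros [| [| n]].
    - now rewrite a0.
    - now rewrite a1.
    - rewrite an by lia; reflexivity. }
  assert (Eb : b = fun n => RtoC (Re (b n))).
  { apply functional_extensionality; intros [| n].
    - now rewrite b0.
    - rewrite bn by lia; reflexivity. }
  assert (P : sign_pattern (fun n => Re (a n)) (fun n => Re (b n))).
  { repeat split.
    - now rewrite a0.
    - now rewrite a1.
    - now rewrite b0.
    - intros n hn; rewrite an by exact hn; simpl; generalize (Cmod_ge_0 (a n)); lra.
    - intros n hn; rewrite bn by exact hn; apply Cmod_ge_0. }
  rewrite Ea in Ha, Hf, HRe; rewrite Eb in Hb, Hf, HRe.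
  apply analytic_coefs_RtoC in Ha, Hb.
  (* Both sequences travel in one pair, so that a single application of choice can pick them for all
     functions of the family. *)
  exists (fun n => Re (a n), fun n => Re (b n)); simpl.
  repeat (split; [assumption |]); split; [| now split].
  intros r hr; apply (gap_pos_of_sense_preserving f); try assumption.
  - now rewrite a1.
  - eapply Rle_lt_trans; [| exact b1]; eapply Rle_trans; [apply Rle_abs | apply re_le_Cmod].
Qed.

Lemma HMbar_of_coefs (beta lambda k nu : R) (u v : nat -> R) :
  sign_pattern u v -> conv_disc u -> conv_disc v ->
  (forall r, 0 <= r < 1 -> 0 < gap u v r) ->
  (forall r theta, 0 < r < 1 -> beta < Re (HM_expr lambda k
     (Omega nu (fun n => RtoC (u n)) (fun n => RtoC (v n))) r theta)) ->
  HMbar beta lambda k nu (harm (fun n => RtoC (u n)) (fun n => RtoC (v n))).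
Proof.
  intros P Hu Hv Hgap HRe; exists (fun n => RtoC (u n)), (fun n => RtoC (v n)).
  pose proof P as (u0 & u1 & v0 & un & vn).
  split; [split; [| exact HRe] | split].
  - split; [| split; [| split; [auto | split]]].
    + split; [now rewrite u0 | split; [now rewrite u1 |]]; now apply analytic_coefs_RtoC.
    + split; [now rewrite v0 | split; [| now apply analytic_coefs_RtoC]].
      rewrite Cmod_R, Rabs_pos_eq by (apply vn; lia).
      (* The condition [|b_1| < 1] is the positivity of [gap] at [0], where it equals [1 - v 1]. *)
      assert (g0 := Hgap 0 ltac:(lra)).
      replace (gap u v 0) with (1 - v 1%nat) in g0; [lra |].
      unfold gap; rewrite Series_incr_1_aux by (simpl; ring).
      change (1 - v 1%nat = PSeries (PS_derive (fun n => u n - v n)) 0).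
      rewrite PSeries_0; unfold PS_derive; rewrite u1; simpl; ring.
    + intros z w hz hw; now apply gap_pos_univalent.
    + now apply gap_pos_sense_preserving.
  - intros n hn; rewrite Cmod_R, Rabs_left1, Ropp_involutive by now apply un. reflexivity.
  - intros n hn; now rewrite Cmod_R, Rabs_pos_eq by now apply vn.
Qed.

(** * Convex combinations *)

Lemma is_series_eq (a b : nat -> R) (la lb : R) :
  (forall n, a n = b n) -> la = lb -> is_series a la -> is_series b lb.
Proof. intros ab <-; now apply is_series_ext. Qed.

(** Values of [harm] and angular derivatives of [Omega] both have this shape, so it serves the
    pointwise sum as well as the defining inequality. *)
Lemma is_series_convex_pair (t : nat -> R) (u v : nat -> nat -> R) (w w' : nat -> R) :
  (forall i, 0 <= t i) -> is_series t 1 ->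
  (forall i n, Rabs (u i n) <= 1) -> (forall i n, Rabs (v i n) <= 1) ->
  ex_series (fun n => Rabs (w n)) -> ex_series (fun n => Rabs (w' n)) ->
  is_series (fun i => Cmult (RtoC (t i))
      (Series (fun n => w n * (u i n + v i n)), Series (fun n => w' n * (u i n - v i n))))
    (Series (fun n => w n * (Series (fun i => t i * u i n) + Series (fun i => t i * v i n))),
     Series (fun n => w' n * (Series (fun i => t i * u i n) - Series (fun i => t i * v i n)))).
Proof.
  intros t0 Ht Hu Hv Hw Hw'.
  assert (ex : forall x : nat -> R, (forall i, Rabs (x i) <= 1) -> ex_series (fun i => t i * x i)).
  { intros x Hx; apply (ex_series_dominated _ t 1); [| now exists 1].
    intros i; rewrite Rabs_mult, Rabs_pos_eq, Rmult_comm by apply t0.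
    apply Rmult_le_compat_r; auto. }
  apply is_series_C; split.
  - assert (S := is_series_exchange t 1 2 w (fun i n => u i n + v i n) t0 Ht Hw
      (fun i n => Rle_trans _ _ _ (Rabs_triang _ _) (Rplus_le_compat _ _ _ _ (Hu i n) (Hv i n)))).
    revert S; apply is_series_eq.
    + intros i; unfold Re; simpl; ring.
    + apply Series_ext; intros n; f_equal.
      rewrite <- Series_plus by auto; apply Series_ext; intros; ring.
  - assert (B : forall i n, Rabs (u i n - v i n) <= 2).
    { intros i n; eapply Rle_trans; [apply Rabs_triang |]; rewrite Rabs_Ropp.
      generalize (Hu i n) (Hv i n); lra. }
    assert (S := is_series_exchange t 1 2 w' (fun i n => u i n - v i n) t0 Ht Hw' B).
    revert S; apply is_series_eq.
    + intros i; unfold Im; simpl; ring.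
    + apply Series_ext; intros n; f_equal.
      rewrite <- Series_minus by auto; apply Series_ext; intros; ring.
Qed.

(** [HM_expr] is complex linear in the derivatives of orders [0], [1] and [2]. Its denominators do
    not depend on the function and stay as unevaluated constants. *)
Lemma is_series_HM_expr (lambda k : R) (t : nat -> R) (G : nat -> C -> C) (F : C -> C)
    (r theta : R) :
  (forall m, (m <= 2)%nat ->
     is_series (fun i => Cmult (RtoC (t i)) (dtheta m (G i) r theta)) (dtheta m F r theta)) ->
  is_series (fun i => t i * Re (HM_expr lambda k (G i) r theta)) (Re (HM_expr lambda k F r theta)).
Proof.
  intros H.
  assert (E : forall g, HM_expr lambda k g r theta =
    (RtoC (1 - lambda) * / polar r theta * dtheta 0 g r theta
     + RtoC (lambda * (1 - k)) * / dtheta 1 (fun z => z) r theta * dtheta 1 g r theta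
     + RtoC (lambda * k) * / dtheta 2 (fun z => z) r theta * dtheta 2 g r theta)%C).
  { intros g; unfold HM_expr, Cdiv.
    replace (g (polar r theta)) with (dtheta 0 g r theta) by (symmetry; apply surjective_pairing).
    ring. }
  assert (S : is_series (fun i => Cmult (RtoC (t i)) (HM_expr lambda k (G i) r theta))
    (HM_expr lambda k F r theta)).
  { rewrite E.
    generalize (is_series_plus _ _ _ _ (is_series_plus _ _ _ _
      (is_series_scal_l (K := C_AbsRing) (V := C_NormedModule)
         (RtoC (1 - lambda) * / polar r theta)%C _ _ (H 0%nat ltac:(lia)))
      (is_series_scal_l (K := C_AbsRing) (V := C_NormedModule)
         (RtoC (lambda * (1 - k)) * / dtheta 1 (fun z => z) r theta)%C _ _ (H 1%nat ltac:(lia))))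
      (is_series_scal_l (K := C_AbsRing) (V := C_NormedModule)
         (RtoC (lambda * k) * / dtheta 2 (fun z => z) r theta)%C _ _ (H 2%nat ltac:(lia)))).
    apply is_series_ext; intros i; rewrite E.
    change (@plus C_NormedModule) with Cplus; change (@scal C_AbsRing C_NormedModule) with Cmult.
    match goal with |- ?a = ?b => change (@eq C a b) end; ring. }
  apply is_series_C in S; destruct S as [S _]; revert S; apply is_series_ext; intros i.
  unfold Re; simpl; ring.
Qed.

Theorem theorem3p2 :
  forall beta lambda k nu : R,
    0 <= k <= 1 -> 0 < beta <= 1 -> 0 <= lambda -> 0 <= nu < 1 ->
  forall (f : nat -> C -> C) (t : nat -> R),
    (forall i : nat, HMbar beta lambda k nu (f i)) ->
    (forall i : nat, 0 <= t i <= 1) ->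
    is_series t 1 ->
  exists F : C -> C,
    (forall z : C, in_disc z ->
       is_series (fun i : nat => Cmult (RtoC (t i)) (f i z)) (F z)) /\
    HMbar beta lambda k nu F.
Proof.
  intros beta lambda k nu _ _ _ hnu f t Hf ht Ht.
  assert (t0 : forall i, 0 <= t i) by apply ht.
  destruct (functional_choice _ (fun i => HMbar_coefs _ _ _ _ _ (Hf i))) as [uv Huv].
  set (u := fun i => fst (uv i)) in *; set (v := fun i => snd (uv i)) in *.
  assert (P : forall i, sign_pattern (u i) (v i)) by apply Huv.
  assert (Cu : forall i, conv_disc (u i)) by apply Huv.
  assert (Cv : forall i, conv_disc (v i)) by apply Huv.
  assert (Hgap : forall i r, 0 <= r < 1 -> 0 < gap (u i) (v i) r) by apply Huv.
  assert (Ef : forall i z, in_disc z ->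
    f i z = harm (fun n => RtoC (u i n)) (fun n => RtoC (v i n)) z) by apply Huv.
  assert (HRe : forall i r theta, 0 < r < 1 -> beta < Re (HM_expr lambda k
    (Omega nu (fun n => RtoC (u i n)) (fun n => RtoC (v i n))) r theta)) by apply Huv.
  clearbody u v; clear uv Huv Hf.
  assert (Bu : forall i n, Rabs (u i n) <= 1) by (intros; apply (gap_pos_bounded (u i) (v i)); auto).
  assert (Bv : forall i n, Rabs (v i n) <= 1) by (intros; apply (gap_pos_bounded (u i) (v i)); auto).
  (* The combination is formed on coefficients; that it is the pointwise sum becomes an interchange
     with the weights [Re (z ^ n)] and [Im (z ^ n)]. *)
  set (U := fun n => Series (fun i => t i * u i n)).
  set (V := fun n => Series (fun i => t i * v i n)).
  assert (comb : forall x : nat -> R, (forall i, Rabs (x i) <= 1) ->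
    ex_series (fun i => t i * x i) /\ Rabs (Series (fun i => t i * x i)) <= 1).
  { intros x Hx.
    assert (B : forall i, Rabs (t i * x i) <= t i).
    { intros i; rewrite Rabs_mult, Rabs_pos_eq by apply t0.
      generalize (t0 i) (Hx i); nra. }
    assert (A : ex_series (fun i => Rabs (t i * x i))).
    { apply (ex_series_dominated _ t 1); [| now exists 1].
      intros i; rewrite Rabs_Rabsolu, Rmult_1_l; apply B. }
    split; [now apply ex_series_Rabs |].
    eapply Rle_trans; [now apply Series_Rabs |].
    rewrite <- (is_series_unique t 1 Ht); apply Series_le; [| now exists 1].
    intros i; split; [apply Rabs_pos | apply B]. }
  assert (CU : conv_disc U) by (apply (conv_disc_bounded _ 1); intros; now apply comb).
  assert (CV : conv_disc V) by (apply (conv_disc_bounded _ 1); intros; now apply comb).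
  assert (const : forall x a, (forall i : nat, x i = a) -> Series (fun i => t i * x i) = a).
  { intros x a Hx; rewrite (Series_ext _ (fun i => t i * a)) by (intros; now rewrite Hx).
    rewrite Series_scal_r, (is_series_unique t 1 Ht); ring. }
  assert (nonneg : forall x, (forall i : nat, 0 <= x i) -> (forall i, Rabs (x i) <= 1) ->
    0 <= Series (fun i => t i * x i)).
  { intros x Hx Bx; rewrite <- (const (fun _ => 0) 0 (fun _ => eq_refl)).
    apply Series_le; [| now apply comb].
    intros i; generalize (t0 i) (Hx i); nra. }
  assert (PU : sign_pattern U V).
  { repeat split.
    - apply const; intros i; apply P.
    - apply const; intros i; apply P.
    - apply const; intros i; apply P.
    - intros n hn; unfold U.
      rewrite (Series_ext _ (fun i => - (t i * - u i n))) by (intros; ring).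
      rewrite Series_opp.
      enough (0 <= Series (fun i => t i * - u i n)) by lra.
      apply nonneg; [| intros i; rewrite Rabs_Ropp; apply Bu].
      intros i; assert (u i n <= 0) by now apply P.
      lra.
    - intros n hn; apply nonneg; [| auto]; intros i; now apply P. }
  assert (exw : forall (L : C -> R) z, (forall w, Rabs (L w) <= Cmod w) -> in_disc z ->
    ex_series (fun n => Rabs (L (z ^ n)%C))).
  { intros L z HL hz; apply (ex_series_dominated _ (fun n => Cmod z ^ n) 1).
    - intros n; rewrite Rabs_Rabsolu, Rmult_1_l, <- Cmod_pow; apply HL.
    - apply ex_series_geom; rewrite Rabs_pos_eq by apply Cmod_ge_0; exact hz. }
  exists (harm (fun n => RtoC (U n)) (fun n => RtoC (V n))); split.
  - intros z hz.
    assert (Ez : forall x y : nat -> R, conv_disc x -> conv_disc y ->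
      harm (fun n => RtoC (x n)) (fun n => RtoC (y n)) z =
      (Series (fun n => Re (z ^ n)%C * (x n + y n)), Series (fun n => Im (z ^ n)%C * (x n - y n)))).
    { intros x y Hx Hy; rewrite harm_RtoC by assumption.
      f_equal; apply Series_ext; intros; ring. }
    rewrite Ez by assumption.
    generalize (is_series_convex_pair t u v _ _ t0 Ht Bu Bv
      (exw Re z re_le_Cmod hz) (exw Im z im_le_Cmod hz)).
    apply is_series_ext; intros i; now rewrite Ef, Ez.
  - apply HMbar_of_coefs; try assumption.
    + intros r hr.
      (* [gap] at [r] is the functional with weights [n * r ^ (n - 1)], the terms of the
         differentiated geometric series. *)
      assert (W : ex_series (fun n => Rabs (INR n * r ^ pred n))).
      { apply (ex_series_ext (fun n => Rabs (INR n * 1) * r ^ pred n)).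
        - intros n; now rewrite Rmult_1_r, Rabs_mult, (Rabs_pos_eq (r ^ _)) by (apply pow_le; lra).
        - apply conv_disc_pred; [| exact hr].
          apply (conv_disc_INR (fun _ => 1)), (conv_disc_bounded _ 1); intros; rewrite Rabs_R1; lra. }
      assert (B2 : forall i n, Rabs (u i n - v i n) <= 2).
      { intros i n; eapply Rle_trans; [apply Rabs_triang |]; rewrite Rabs_Ropp.
        generalize (Bu i n) (Bv i n); lra. }
      assert (S := is_series_exchange t 1 2 _ (fun i n => u i n - v i n) t0 Ht W B2).
      apply Ropp_lt_cancel; rewrite Ropp_0.
      apply (is_series_convex_lt t (fun i => - gap (u i) (v i) r) 0 _ t0 Ht).
      * intros i; generalize (Hgap i r hr); lra.
      * replace (- gap U V r) with (-1 * Series (fun n => INR n * r ^ pred n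
          * Series (fun i => t i * (u i n - v i n)))).
        -- generalize (is_series_scal_l (K := R_AbsRing) (V := R_NormedModule) (-1) _ _ S).
           apply is_series_ext; intros i; unfold gap.
           rewrite (Series_ext (fun n => INR n * (u i n - v i n) * r ^ pred n)
             (fun n => INR n * r ^ pred n * (u i n - v i n))) by (intros; ring).
           match goal with |- scal _ (_ * ?x) = _ => change (-1 * (t i * x) = t i * - x) end; ring.
        -- replace (- gap U V r) with (-1 * gap U V r) by ring; f_equal; apply Series_ext; intros n.
           unfold U, V; rewrite <- Series_minus by (now apply comb).
           rewrite (Series_ext (fun i => t i * (u i n - v i n))
             (fun i => t i * u i n - t i * v i n)) by (intros; ring); ring.
    + intros r theta hr; apply Ropp_lt_cancel.
      (* [is_series_convex_lt] gives strict upper bounds; negation turns the lower bound [beta] into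
         one. *)
      apply (is_series_convex_lt t (fun i => - Re (HM_expr lambda k
        (Omega nu (fun n => RtoC (u i n)) (fun n => RtoC (v i n))) r theta)) (- beta) _ t0 Ht).
      * intros i; generalize (HRe i r theta hr); lra.
      * assert (S : is_series (fun i => t i * Re (HM_expr lambda k
          (Omega nu (fun n => RtoC (u i n)) (fun n => RtoC (v i n))) r theta))
          (Re (HM_expr lambda k (Omega nu (fun n => RtoC (U n)) (fun n => RtoC (V n))) r theta))).
        { apply is_series_HM_expr; intros m hm.
          destruct (dtheta_Omega_weights nu r theta m hnu ltac:(lra) hm) as (w & w' & Hw & Hw' & D).
          rewrite D by assumption.
          generalize (is_series_convex_pair t u v w w' t0 Ht Bu Bv Hw Hw').
          apply is_series_ext; intros i; now rewrite D. }
        generalize (is_series_opp _ _ S); apply is_series_ext; intros i.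
        change (- (t i * Re (HM_expr lambda k
          (Omega nu (fun n => RtoC (u i n)) (fun n => RtoC (v i n))) r theta))
          = t i * - Re (HM_expr lambda k
          (Omega nu (fun n => RtoC (u i n)) (fun n => RtoC (v i n))) r theta)); ring.
Qed.
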